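(* Consider minimizing $f(x)=\frac{1}{Mn}\sum_{m\in[M],j\in[n]}f_{m,j}(x)$ over $\mathcal{K}\subseteq\mathbb{R}^d$, where $\mathcal{K}$ is convex and compact with diameter $D=\sup_{x,y\in\mathcal{K}}\|x-y\|$, and where all $f_{m,j}$ are convex and $L$-smooth on $\mathcal{K}$ with $\|\nabla f_{m,j}(x)\|_\infty\le G_\infty$ for all $x\in\mathcal{K}$, $m\in[M]$, $j\in[n]$. Run the Quantized Frank-Wolfe (QFW) algorithm described in the context for $T$ rounds from $x_1\in\mathcal{K}$ with: $p_i=2^{i-1}$; $\mathcal{S}_{i,1}^m=\{f_{m,j}:j\in[n]\}$ (each worker uses all its $n$ functions when $k=1$); $S_{i,k}=p_i/M=2^{i-1}/M$ for $i\ge1,k\ge2$; $\eta_{i,k}=2/(p_i+k)$; and the $s$-Partition Encoding Scheme with levels $s_{1,i,1}=\sqrt{dp_i^2/M}$, $s_{2,i,1}=\sqrt{dp_i^2}$ for $k=1$, and $s_{1,i,k}=\sqrt{dp_i/M}$, $s_{2,i,k}=\sqrt{dp_i}$ for $k\ge2$. Then $x_{T+1}\in\mathcal{K}$ and $$\mathbb{E}[f(x_{T+1})]-f(x^* )\le\frac{4D\sqrt{2(G_\infty^2+6L^2D^2)}+2LD^2}{T},$$ where $x^*$ is a minimizer of $f$ on $\mathcal{K}$.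
   Context: $\|\cdot\|$ is the Euclidean norm, $[n]=\{1,\dots,n\}$. There are $M$ workers and a master; $N=Mn$ and worker $m$ has access to the functions $f_{m,j}$, $j\in[n]$. A function is $L$-smooth on $\mathcal{K}$ if its gradient is $L$-Lipschitz on $\mathcal{K}$. $s$-Partition Encoding Scheme: for $g\in\mathbb{R}^d$ and each coordinate $i$, find $l_i\in\{0,\dots,s-1\}$ with $|g_i|/\|g\|_\infty\in[l_i/s,(l_i+1)/s]$ and let $b_i=l_i/s$ with probability $1-\frac{|g_i|}{\|g\|_\infty}s+l_i$, and $b_i=(l_i+1)/s$ with probability $\frac{|g_i|}{\|g\|_\infty}s-l_i$. The transmitted data are $\mathrm{sign}(g_i)b_i$ and $\|g\|_\infty$; the decoded vector $\phi'(g)$ has coordinates $\mathrm{sign}(g_i)b_i\|g\|_\infty$ (and $\phi'(0)=0$). QFW: rounds $t=1,\dots,T$ are grouped in consecutive periods of lengths $p_1,p_2,\dots$; round $t$ corresponds to $(i,k)$ with $t=\sum_{j=1}^{i-1}p_j+k$, $1\le k\le p_i$, and $x_{i,k}=x_t$, $\eta_{i,k}=\eta_t$. In round $(i,k)$ each worker $m$ takes a collection $\mathcal{S}_{i,k}^m$ of its local functions; for $k\ge2$ it consists of $S_{i,k}$ functions sampled uniformly at random (with replacement) from its $n$ functions. Writing $f_{\mathcal{S}}$ for the average of the functions in $\mathcal{S}$, the worker computes $g_{i,1}^m=\nabla f_{\mathcal{S}_{i,1}^m}(x_t)$ if $k=1$, and $g_{i,k}^m=\nabla f_{\mathcal{S}_{i,k}^m}(x_t)-\nabla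 f_{\mathcal{S}_{i,k}^m}(x_{t-1})$ if $k\ge2$, and sends it encoded with level $s_{1,i,k}$. The master decodes these to $\Phi_{1,i,k}'(g_{i,k}^m)$, forms $\tilde g_{i,k}=\frac1M\sum_{m=1}^M\Phi_{1,i,k}'(g_{i,k}^m)$, and broadcasts it encoded with level $s_{2,i,k}$; workers decode it to $\Phi_{2,i,k}'(\tilde g_{i,k})$ and set $\bar g_{i,1}=\Phi_{2,i,1}'(\tilde g_{i,1})$ if $k=1$, $\bar g_{i,k}=\Phi_{2,i,k}'(\tilde g_{i,k})+\bar g_{i,k-1}$ if $k\ge2$. Then $v_{i,k}\in\arg\min_{v\in\mathcal{K}}\langle v,\bar g_{i,k}\rangle$ and $x_{t+1}=x_t+\eta_{i,k}(v_{i,k}-x_t)$. All random choices (sampling, encodings) are independent across coordinates, workers and rounds. Sample sizes and levels that are not integers are rounded up to the next positive integer. *)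

(* Defs.v *)
From HB Require Import structures.
From mathcomp Require Import all_boot all_order all_algebra.
From mathcomp Require Import all_classical all_reals all_analysis.

Set Implicit Arguments.
Unset Strict Implicit.
Unset Printing Implicit Defensive.

Import Order.TTheory GRing.Theory Num.Theory.
Import numFieldNormedType.Exports.

Local Open Scope classical_set_scope.
Local Open Scope ring_scope.

(* On row vectors the norm `|g| is the max norm ||g||_oo; the Euclidean norm is
   norm2. *)

Section Euclidean.
Context {R : realType} {d : nat}.
Implicit Types (u v x y : 'rV[R]_d) (K : set 'rV[R]_d) (f : 'rV[R]_d -> R).

Definition dotv u v : R := \sum_(i < d) u 0 i * v 0 i.

Definition norm2 u : R := Num.sqrt (dotv u u).

Definition diameter K : R :=
  sup [set norm2 (p.1 - p.2) | p in [set p | K p.1 /\ K p.2]].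

Definition grad f x : 'rV[R]_d := \row_i 'D_(delta_mx 0 i) (f : _ -> R^o) x.

(* Differentiability is in the ambient space R^d, at the points of K only. *)
Definition smooth_on K (L : R) f : Prop :=
  (forall x, K x -> differentiable (f : _ -> R^o) x) /\
  (forall x y, K x -> K y -> norm2 (grad f x - grad f y) <= L * norm2 (x - y)).

Definition is_minimizer K f x : Prop := K x /\ forall y, K y -> f x <= f y.

End Euclidean.

Definition roundup {R : realType} (r : R) : nat := maxn 1 `|Num.ceil r|%N.

Section PartitionEncoding.
Context {R : realType} {d : nat}.
Implicit Types (s : nat) (g : 'rV[R]_d) (i : 'I_d) (up : {ffun 'I_d -> bool}).

(* The index l_i of a subinterval [l_i/s, (l_i+1)/s] containing |g_i|/||g||_oo.
   When the ratio is an interior partition point two indices are admissible;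
   both give the same law for the rounded value b_i. *)
Definition enc_idx s g i : nat :=
  minn s.-1 (Num.truncn (`|g 0 i| / `|g| * s%:R)).

Lemma le_abs_coord g i : `|g 0 i| <= `|g|.
Proof.
rewrite [leRHS]/Num.norm /= mx_normrE.
by apply/bigmax_geP; right => /=; exists (0, i).
Qed.

Lemma enc_idxP s g i : (0 < s)%N ->
  (enc_idx s g i < s)%N /\
  (enc_idx s g i)%:R / s%:R <= `|g 0 i| / `|g| <= (enc_idx s g i).+1%:R / s%:R.
Proof.
move=> s0; have sR : 0 < s%:R :> R by rewrite ltr0n.
have r0 : 0 <= `|g 0 i| / `|g| * s%:R by rewrite mulr_ge0 ?divr_ge0.
have r1 : `|g 0 i| / `|g| <= 1.
  have [->|g0] := eqVneq `|g| 0; first by rewrite invr0 mulr0.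
  by rewrite ler_pdivrMr ?mul1r ?le_abs_coord// lt_neqAle eq_sym g0 normr_ge0.
split.
  by rewrite /enc_idx (leq_ltn_trans (geq_minl _ _))// prednK.
rewrite ler_pdivrMr// ler_pdivlMr//; apply/andP; split.
  apply: (@le_trans _ _ (Num.truncn (`|g 0 i| / `|g| * s%:R))%:R).
    by rewrite ler_nat geq_minr.
  by rewrite truncn_le.
rewrite /enc_idx; case: (leqP s.-1) => h.
  by rewrite prednK// ler_piMl// ltW.
by rewrite ltW// truncnS_gt.
Qed.

(* A bit up i records whether coordinate i is rounded up, to b_i = (l_i+1)/s,
   or down, to b_i = l_i/s; enc_prob is the probability of that bit. *)
Definition enc_prob s g i (b : bool) : R :=
  let q := `|g 0 i| / `|g| * s%:R - (enc_idx s g i)%:R in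
  if b then q else 1 - q.

Definition decode s g up : 'rV[R]_d :=
  \row_i (Num.sg (g 0 i) * ((enc_idx s g i + up i)%:R / s%:R) * `|g|).

End PartitionEncoding.

Section Rounds.
Variable p : nat -> nat.

Definition next_round (ik : nat * nat) : nat * nat :=
  if (ik.2 < p ik.1)%N then (ik.1, ik.2.+1) else (ik.1.+1, 1%N).

(* The pair (i, k) of the round t >= 1, all three counted from 1. *)
Definition round_index (t : nat) : nat * nat := iter t.-1 next_round (1%N, 1%N).

Lemma round_indexP t : (forall i, (0 < p i)%N) -> (0 < t)%N ->
  [/\ (0 < (round_index t).1)%N,
      (t = \sum_(1 <= j < (round_index t).1) p j + (round_index t).2)%N
    & (1 <= (round_index t).2 <= p (round_index t).1)%N].
Proof.
move=> p0; case: t => // t _; rewrite /round_index /=.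
elim: t => [|t]; first by rewrite big_geq// p0.
rewrite iterS; case: (iter _ _ _) => i k /= [i0 tE /andP[k0 kp]].
rewrite /next_round /=; case: (ltnP k (p i)) => h /=.
  by split=> //; rewrite addnS -tE.
have kE : k = p i by apply/eqP; rewrite eqn_leq kp h.
by split=> //; rewrite big_nat_recr//= addn1 tE kE.
Qed.

End Rounds.

Record qfw_params (R : realType) := QFWParams {
  period : nat -> nat;
  batch : nat * nat -> nat;
  stepsize : nat * nat -> R;
  level1 : nat * nat -> nat;
  level2 : nat * nat -> nat }.

Section QFW.
Context {R : realType} {d M n : nat}.

Definition avg_fun (phi : 'I_n -> 'rV[R]_d -> R) (S : seq 'I_n)
  (x : 'rV[R]_d) : R := (size S)%:R^-1 * \sum_(j <- S) phi j x.

Definition objective (f : 'I_M -> 'I_n -> 'rV[R]_d -> R) (x : 'rV[R]_d) : R :=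
  (M * n)%:R^-1 * \sum_(m < M) \sum_(j < n) f m j x.

(* The random choices of one round: the collection of functions taken by each
   worker (as a sequence of indices), the rounding bits of the M workers'
   encodings, and the rounding bits of the master's encoding. *)
Definition draw : Type :=
  ({ffun 'I_M -> seq 'I_n} * {ffun 'I_M -> {ffun 'I_d -> bool}}
   * {ffun 'I_d -> bool})%type.
Definition coll (w : draw) (m : 'I_M) : seq 'I_n := w.1.1 m.
Definition bits1 (w : draw) (m : 'I_M) : {ffun 'I_d -> bool} := w.1.2 m.
Definition bits2 (w : draw) : {ffun 'I_d -> bool} := w.2.

(* At the start of round t: x_t, x_(t-1) and the estimate computed in round
   t-1.  The last two are not used when k = 1. *)
Record state := State { cur : 'rV[R]_d; prv : 'rV[R]_d; est : 'rV[R]_d }.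

Variables (f : 'I_M -> 'I_n -> 'rV[R]_d -> R) (x1 : 'rV[R]_d).
Variable prm : qfw_params R.
(* The vector v_(i,k) may be any element of the argmin, chosen according to
   everything drawn so far. *)
Variable lmo : seq draw -> 'rV[R]_d -> 'rV[R]_d.

Definition worker_vec (ik : nat * nat) (st : state) (w : draw) (m : 'I_M) :
    'rV[R]_d :=
  let fS := avg_fun (f m) (coll w m) in
  if ik.2 == 1%N then grad fS (cur st) else grad fS (cur st) - grad fS (prv st).

Definition master_vec (ik : nat * nat) (st : state) (w : draw) : 'rV[R]_d :=
  M%:R^-1 *: \sum_(m < M)
    decode (level1 prm ik) (worker_vec ik st w m) (bits1 w m).

Definition estimate (ik : nat * nat) (st : state) (w : draw) : 'rV[R]_d :=
  let dec := decode (level2 prm ik) (master_vec ik st w) (bits2 w) in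
  if ik.2 == 1%N then dec else dec + est st.

(* Histories list the draws of the rounds performed, the latest one first. *)
Fixpoint qfw (h : seq draw) : state :=
  if h is w :: h' then
    let st := qfw h' in
    let ik := round_index (period prm) (size h) in
    let gbar := estimate ik st w in
    let v := lmo h gbar in
    State (cur st + stepsize prm ik *: (v - cur st)) (cur st) gbar
  else State x1 x1 0.

Definition coll_prob (ik : nat * nat) (S : seq 'I_n) : R :=
  if ik.2 == 1%N then (S == enum 'I_n)%:R
  else (size S == batch prm ik)%:R * n%:R^-1 ^+ size S.

(* Probability, given the draws h of the previous rounds, that the next round
   draws w.  The factors are the laws of the collections, of the workers'
   rounding bits given the collections, and of the master's rounding bits given
   all of these; the product over workers, samples and coordinates expresses
   their independence. *)
Definition draw_prob (h : seq draw) (w : draw) : R :=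
  let st := qfw h in
  let ik := round_index (period prm) (size h).+1 in
  (\prod_(m < M) coll_prob ik (coll w m)) *
  (\prod_(m < M) \prod_(c < d)
     enc_prob (level1 prm ik) (worker_vec ik st w m) c (bits1 w m c)) *
  (\prod_(c < d)
     enc_prob (level2 prm ik) (master_vec ik st w) c (bits2 w c)).

Definition history {Omega : Type} (xi : nat -> Omega -> draw) (t : nat)
  (om : Omega) : seq draw := [seq xi s om | s <- rev (iota 1 t)].

Definition qfw_iter {Omega : Type} (xi : nat -> Omega -> draw) (t : nat)
  (om : Omega) : 'rV[R]_d := cur (qfw (history xi t.-1 om)).

(* xi 1, ..., xi T are the random choices of a T-round run: each is a discrete
   random element, with conditional law draw_prob given the earlier ones. *)
Record qfw_run {disp : measure_display} {Omega : measurableType disp}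
    (P : probability Omega R) (T : nat) (xi : nat -> Omega -> draw) : Prop := {
  run_measurable : forall t w, (1 <= t <= T)%N ->
    measurable [set om | xi t om = w];
  run_law : forall h w, (size h < T)%N ->
    P [set om | history xi (size h).+1 om = w :: h] =
    (P [set om | history xi (size h) om = h] * (draw_prob h w)%:E)%E }.

End QFW.
Arguments draw : clear implicits.

Definition is_lmo {R : realType} {d : nat} {H : Type} (K : set 'rV[R]_d)
    (lmo : H -> 'rV[R]_d -> 'rV[R]_d) : Prop :=
  forall h g, is_minimizer K (fun v => dotv v g) (lmo h g).

Definition qfw_schedule (R : realType) (d M : nat) : qfw_params R :=
  let p i : nat := (2 ^ i.-1)%N in
  {| period := p;
     batch ik := roundup ((p ik.1)%:R / M%:R : R);
     stepsize ik := 2 / (p ik.1 + ik.2)%:R;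
     level1 ik :=
       if ik.2 == 1%N then roundup (Num.sqrt (d%:R * (p ik.1)%:R ^+ 2 / M%:R : R))
       else roundup (Num.sqrt (d%:R * (p ik.1)%:R / M%:R : R));
     level2 ik :=
       if ik.2 == 1%N then roundup (Num.sqrt (d%:R * (p ik.1)%:R ^+ 2 : R))
       else roundup (Num.sqrt (d%:R * (p ik.1)%:R : R)) |}.

(* Main.v *)
Require Import Defs.
From HB Require Import structures.
From mathcomp Require Import all_boot all_order all_algebra.
From mathcomp Require Import all_classical all_reals all_analysis.
From mathcomp Require Import measurable_realfun ring lra.

(** A Frank-Wolfe step along a vertex [v] that is optimal for an estimate [g]
    of the gradient at [x] satisfies, by the descent lemma and convexity,
      [gap' <= (1 - eta) gap + eta D |g - grad F x| + L eta^2 D^2 / 2],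
    where [gap] is the excess of the objective [F] over its minimum
    ([gap_step]).  Everything therefore rests on a bound for the expected error
    of the estimate.

    Inside a period of length [p] the estimate is a sum of increments, each of
    which is unbiased given the past.  Hence the mean square error of a round is
    that of the previous round plus the variance of the new increment
    ([grad_error_next]), and the first round of the period starts afresh from
    exact local gradients ([grad_error_first]).  The variance has three sources:
    the samples, the workers' encodings and the master's encoding.  They are
    revealed one after the other, each has mean zero given the earlier ones, and
    independence over workers, samples and coordinates turns each variance into
    a sum ([indep_sum_sqr], [communication_sqr]).  Rounding moves a coordinate
    of [g] by at most [|g|_oo / s], so the prescribed levels make each encoding
    cost at most [G^2 / p^2] in the first round of a period, and [B^2 / p] later,
    where [B] bounds the difference of two successive gradients; averaging
    [M S >= p] samples costs [B^2 / p] as well.  Since successive iterates are at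
    distance at most [2 D / p], one has [B <= 2 L D / p], and over the at most
    [p] rounds of a period the mean square error stays below
    [sigma^2 / p^2] with [sigma^2 = 2 (G^2 + 6 L^2 D^2)] ([expect_grad_error]).

    The doubling periods satisfy [t + 1 = p + k] in round [(i, k)] of index [t]
    ([doubling_round]).  So the step size is [2 / (t + 1)] and
    [1 / p <= 2 / (t + 1)], and the step inequality multiplied by [t (t + 1)]
    shows that [t (t + 1)] times the expected gap grows by at most
    [Q = 4 D sigma + 2 L D^2] per round, which gives the rate [Q / T]
    ([expect_gap]).

    The run itself is a random variable on an abstract probability space.  Its
    conditional laws have finite support, so that expectations of functions of
    the history are finite weighted sums ([expectation_history]), and the whole
    argument takes place on such sums. *)

Set Implicit Arguments.
Unset Strict Implicit.
Unset Printing Implicit Defensive.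

Import Order.TTheory GRing.Theory Num.Theory.
Import numFieldNormedType.Exports.

Local Open Scope classical_set_scope.
Local Open Scope ring_scope.

(** * Euclidean geometry, convexity and smoothness *)

Section InnerProduct.
Context {R : realType} {d : nat}.
Implicit Types (u v w : 'rV[R]_d) (K : set 'rV[R]_d).

Lemma dotvC u v : dotv u v = dotv v u.
Proof. by apply: eq_bigr => i _; rewrite mulrC. Qed.

Lemma dotvDl u v w : dotv (u + v) w = dotv u w + dotv v w.
Proof.
by rewrite -big_split; apply: eq_bigr => i _ /=; rewrite !mxE mulrDl.
Qed.

Lemma dotvZl a u v : dotv (a *: u) v = a * dotv u v.
Proof.
by rewrite /dotv big_distrr/=; apply: eq_bigr => i _; rewrite !mxE mulrA.
Qed.

Lemma dotvNl u v : dotv (- u) v = - dotv u v.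
Proof. by rewrite -scaleN1r dotvZl mulN1r. Qed.

Lemma dotvDr u v w : dotv w (u + v) = dotv w u + dotv w v.
Proof. by rewrite dotvC dotvDl !(dotvC w). Qed.

Lemma dotvNr u v : dotv v (- u) = - dotv v u.
Proof. by rewrite dotvC dotvNl dotvC. Qed.

Lemma dotvZr a u v : dotv v (a *: u) = a * dotv v u.
Proof. by rewrite dotvC dotvZl dotvC. Qed.

Lemma dotv_suml (I : Type) (r : seq I) (P : pred I) (F : I -> 'rV[R]_d) w :
  dotv (\sum_(i <- r | P i) F i) w = \sum_(i <- r | P i) dotv (F i) w.
Proof.
apply: (big_morph (fun u => dotv u w)) => [u v|]; first exact: dotvDl.
by rewrite -(scale0r w) dotvZl mul0r.
Qed.

Lemma dotv00 : dotv (0 : 'rV[R]_d) 0 = 0.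
Proof. by rewrite -[X in dotv X _](scale0r 0) dotvZl mul0r. Qed.

Lemma dotv_ge0 u : 0 <= dotv u u.
Proof. by apply: sumr_ge0 => i _; rewrite -expr2 sqr_ge0. Qed.

Lemma norm2_ge0 u : 0 <= norm2 u. Proof. exact: sqrtr_ge0. Qed.

Lemma norm2_sqr u : norm2 u ^+ 2 = dotv u u.
Proof. by rewrite sqr_sqrtr// dotv_ge0. Qed.

Lemma norm2B u v : norm2 (u - v) = norm2 (v - u).
Proof. by rewrite /norm2 -opprB dotvNl dotvNr opprK. Qed.

Lemma norm2Z a u : norm2 (a *: u) = `|a| * norm2 u.
Proof. by rewrite /norm2 dotvZl dotvZr mulrA -expr2 sqrtrM ?sqr_ge0// sqrtr_sqr. Qed.

(** The Cauchy-Schwarz inequality, from the nonnegativity of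
    [|| |v| u - |u| v ||^2]. *)
Lemma dotv_le_norm2 u v : dotv u v <= norm2 u * norm2 v.
Proof.
have [u0|u0] := eqVneq (norm2 u) 0; last have [v0|v0] := eqVneq (norm2 v) 0.
- have /psumr_eq0P uE : dotv u u = 0 by rewrite -norm2_sqr u0 expr0n.
  rewrite u0 mul0r /dotv big1// => i _.
  have /eqP := uE (fun i _ => sqr_ge0 (u 0 i)) i isT.
  by rewrite mulf_eq0 orbb => /eqP ->; rewrite mul0r.
- have /psumr_eq0P vE : dotv v v = 0 by rewrite -norm2_sqr v0 expr0n.
  rewrite v0 mulr0 /dotv big1// => i _.
  have /eqP := vE (fun i _ => sqr_ge0 (v 0 i)) i isT.
  by rewrite mulf_eq0 orbb => /eqP ->; rewrite mulr0.
have := dotv_ge0 (norm2 v *: u - norm2 u *: v).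
rewrite !(dotvDl, dotvDr, dotvNl, dotvNr, dotvZl, dotvZr) (dotvC v u).
rewrite -!norm2_sqr => h.
have ab : 0 < norm2 u * norm2 v.
  by rewrite mulr_gt0// lt_neqAle eq_sym ?u0 ?v0 norm2_ge0.
rewrite -(ler_pM2l ab); lra.
Qed.

Lemma normv_le_norm2 u : `|u| <= norm2 u.
Proof.
rewrite [leLHS]/Num.norm /= mx_normrE.
apply/bigmax_leP; split; first exact: norm2_ge0.
move=> -[i j] _ /=; rewrite ord1 -sqrtr_sqr ler_sqrt ?dotv_ge0//.
rewrite /dotv (bigD1 j)//= expr2 lerDl.
by apply: sumr_ge0 => k _; rewrite -expr2 sqr_ge0.
Qed.

Lemma norm2_sqr_le_normv u : norm2 u ^+ 2 <= d%:R * `|u| ^+ 2.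
Proof.
rewrite norm2_sqr mulr_natl -[X in _ *+ X]card_ord -sumr_const.
apply: ler_sum => i _; rewrite -expr2 -real_normK ?num_real// lerXn2r ?nnegrE//.
exact: le_abs_coord.
Qed.

Lemma norm2_le_diameter K x y : compact K -> K x -> K y ->
  norm2 (x - y) <= diameter K.
Proof.
move=> /compact_bounded[B [_ KB]] Kx Ky.
apply: ub_le_sup; last by exists (x, y).
exists (Num.sqrt (d%:R * ((B + 1) + (B + 1)) ^+ 2)) => _ [[u v] [/= Ku Kv] <-].
rewrite -[leLHS]ger0_norm ?norm2_ge0// -sqrtr_sqr ler_wsqrtr//=.
apply: (le_trans (norm2_sqr_le_normv _)); rewrite ler_wpM2l//.
have uB : `|u| <= B + 1 by apply: (KB (B + 1)) => //; rewrite ltrDl.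
have vB : `|v| <= B + 1 by apply: (KB (B + 1)) => //; rewrite ltrDl.
have B0 : 0 <= B + 1 := le_trans (normr_ge0 _) uB.
rewrite lerXn2r ?nnegrE ?(addr_ge0 B0 B0)//.
by apply: (le_trans (ler_normB _ _)); exact: lerD.
Qed.

Lemma convex_set_step K (a : R) x y : convex_set K -> 0 <= a <= 1 ->
  K x -> K y -> K (x + a *: (y - x)).
Proof.
move=> cK /andP[a0 a1] Kx Ky.
have -> : x + a *: (y - x) = a *: y + (1 - a) *: x.
  by rewrite scalerBl scale1r scalerBr addrCA.
exact: set_mem (cK y x (Itv01 a0 a1) (mem_set Ky) (mem_set Kx)).
Qed.

End InnerProduct.

Section SmoothConvex.
Context {R : realType} {d : nat}.
Implicit Types (f : 'rV[R]_d -> R) (x y v : 'rV[R]_d) (K : set 'rV[R]_d).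

Lemma dotv_grad f x v : differentiable (f : _ -> R^o) x ->
  dotv (grad f x) v = 'D_v (f : _ -> R^o) x.
Proof.
move=> df; rewrite deriveE// [in RHS](row_sum_delta v) linear_sum.
by apply: eq_bigr => i _; rewrite mxE linearZ/= deriveE// mulrC.
Qed.

Lemma is_derive_line f x v (s : R) :
  differentiable (f : _ -> R^o) (x + s *: v) ->
  is_derive s 1 (fun r : R => f (x + r *: v) : R^o)
    (dotv (grad f (x + s *: v)) v).
Proof.
move=> df; have dv := @diff_derivable _ _ _ _ _ v df.
have E : (fun h : R => h^-1 *: (((fun r : R => f (x + r *: v) : R^o) \o shift s)
    (h *: 1) - (f (x + s *: v) : R^o))) =
  (fun h : R => h^-1 *: (((f : _ -> R^o) \o shift (x + s *: v)) (h *: v)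
     - (f (x + s *: v) : R^o))).
  apply/funext => h /=; congr (_ *: (f _ - _)).
  by rewrite [h%:A]mulr1 scalerDl addrCA.
apply: DeriveDef; first by rewrite /derivable E; exact: dv.
by rewrite /derive E dotv_grad.
Qed.

(** A convex function lies above its tangent planes: the difference quotients
    along a segment are at most the total increase, and tend to the directional
    derivative. *)
Lemma convex_ge_tangent K f x y : convex_function K f -> K x -> K y ->
  differentiable (f : _ -> R^o) x ->
  f x + dotv (grad f x) (y - x) <= f y.
Proof.
move=> cf Kx Ky df.
have := @is_derive_line f x (y - x) 0; rewrite scale0r addr0 => /(_ df) [].
rewrite /derivable /derive scale0r addr0 /= => cv <-.
rewrite -lerBrDl; have /cvg_dnbhs_at_right cvr := cv.
rewrite -(cvg_lim _ cvr)//.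
apply: limr_le; first by apply/cvg_ex; eexists; exact: cvr.
near=> h.
have h0 : 0 < h by near: h; exact: nbhs_right_gt.
have h1 : h <= 1 by near: h; apply: nbhs_right_le.
rewrite addr0 [h%:A]mulr1 [_ *: _]mulrC ler_pdivrMr//.
have -> : x + h *: (y - x) = h *: y + (1 - h) *: x.
  by rewrite scalerBl scale1r scalerBr addrCA.
have : f (h *: y + (1 - h) *: x) <= h * f y + (1 - h) * f x.
  exact: cf (Itv01 (ltW h0) h1) y x (mem_set Ky) (mem_set Kx).
lra.
Unshelve. all: by end_near.
Qed.

(** The descent lemma.  By the mean value theorem it suffices that the
    derivative of the difference of the two sides along the segment is
    nonpositive, which is the Lipschitz bound on the gradient. *)
Lemma smooth_le_quadratic K (L : R) f x y : convex_set K -> smooth_on K L f ->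
  K x -> K y ->
  f y <= f x + dotv (grad f x) (y - x) + L / 2 * norm2 (y - x) ^+ 2.
Proof.
move=> cK [df lf] Kx Ky; set v := y - x; set N := norm2 v ^+ 2.
have Ks (s : R) : 0 <= s <= 1 -> K (x + s *: v) by move=> ?; exact: convex_set_step.
pose h (s : R) : R := f (x + s *: v) - s * dotv (grad f x) v - s ^+ 2 * (L / 2 * N).
pose dh (s : R) : R := dotv (grad f (x + s *: v) - grad f x) v - s * L * N.
have hd (s : R) : 0 <= s <= 1 -> is_derive s 1 (h : R -> R^o) (dh s).
  move=> s01; have := is_derive_line (df _ (Ks s s01)) => ?.
  apply: is_derive_eq.
  rewrite /dh dotvDl dotvNl /GRing.scale /=.
  lra.
have [c /[!in_itv]/= /andP[c0 c1]] :
    exists2 c, c \in `]0, 1[ & h 1 - h 0 = dh c * (1 - 0).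
  apply: MVT => // [s /[!in_itv]/= /andP[s0 s1]|].
    by apply: hd; rewrite !ltW.
  apply: continuous_in_subspaceT => s; rewrite inE/= in_itv/= => s01.
  apply: differentiable_continuous; apply/derivable1_diffP.
  by have [] := hd _ s01.
have dh0 : dh c <= 0.
  rewrite /dh subr_le0 (le_trans (dotv_le_norm2 _ _))//.
  have c01 : 0 <= c <= 1 by rewrite !ltW.
  have H : norm2 (grad f (x + c *: v) - grad f x) <= L * (c * norm2 v).
    by have := lf _ _ (Ks c c01) Kx; rewrite [x + _]addrC addrK norm2Z gtr0_norm.
  rewrite /N expr2 mulrA ler_wpM2r ?norm2_ge0//.
  by rewrite (le_trans H)// mulrCA mulrA.
rewrite subr0 mulr1 /h scale1r scale0r addr0 expr1n expr0n /=.
have -> : x + v = y by rewrite /v addrC subrK.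
move: dh0; set A := f y; set B := f x; set C := dotv _ _; move: (dh c) => e; lra.
Qed.

(** With [L < 0] the Lipschitz bound leaves room for a single point only.  This
    is what allows [L |x - y|^2 <= L D^2] whatever the sign of [L]. *)
Lemma smooth_ge0_or_diameter0 K (L : R) f x : smooth_on K L f -> K x ->
  0 <= L \/ diameter K = 0.
Proof.
move=> [_ lf] Kx; have [|L0] := lerP 0 L; [by left|right].
have E u v : K u -> K v -> norm2 (u - v) = 0.
  move=> Ku Kv; have := lf u v Ku Kv.
  have := norm2_ge0 (grad f u - grad f v); have := norm2_ge0 (u - v).
  nra.
rewrite /diameter; set S := [set _ | _ in _].
suff -> : S = [set 0] by rewrite sup1.
apply/seteqP; split => [_ [[u v] [/= Ku Kv] <-]|_ ->]; first exact: E.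
by exists (x, x) => //=; exact: E.
Qed.

Lemma grad_sum n (g : 'I_n -> 'rV[R]_d -> R) (a : R) x :
  (forall j, differentiable (g j : _ -> R^o) x) ->
  grad (fun y => a * \sum_(j < n) g j y) x = a *: \sum_(j < n) grad (g j) x.
Proof.
move=> dg; apply/rowP => i; rewrite !mxE summxE.
under [in RHS]eq_bigr do rewrite mxE.
have dj j : derivable (g j : _ -> R^o) x (delta_mx 0 i) by exact: diff_derivable.
have -> : (fun y => a * \sum_(j < n) g j y) =
    a *: \sum_(j < n) (g j : 'rV[R]_d -> R^o).
  by apply/funext => y; rewrite /GRing.scale/= fct_sumE.
by rewrite deriveZ ?derive_sum//; exact: derivable_sum.
Qed.

End SmoothConvex.

(** * Sums of independent random vectors *)

Section IndependentFamily.
Context {R : realType} {I A : finType}.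
Variable p : I -> A -> R.
Hypothesis p1 : forall i, \sum_a p i a = 1.

Lemma indep_mass1 : \sum_(u : {ffun I -> A}) \prod_i p i (u i) = 1.
Proof. by rewrite -bigA_distr_bigA big1. Qed.

Let prod_at (g : A -> R) (u : {ffun I -> A}) i :
  g (u i) = \prod_k (if k == i then g (u k) else 1).
Proof.
by rewrite (bigD1 i)//= eqxx big1 ?mulr1// => k /negbTE ->.
Qed.

Lemma indep_marginal (g : A -> R) i :
  \sum_(u : {ffun I -> A}) (\prod_k p k (u k)) * g (u i) = \sum_a p i a * g a.
Proof.
under eq_bigr do rewrite prod_at -big_split /=.
rewrite -(bigA_distr_bigA (fun k a => p k a * (if k == i then g a else 1))).
rewrite (bigD1 i)//= eqxx [X in _ * X]big1 ?mulr1// => k /negbTE ->.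
by under eq_bigr do rewrite mulr1.
Qed.

Lemma indep_mean (V : lmodType R) (X : I -> A -> V) :
  \sum_(u : {ffun I -> A}) (\prod_i p i (u i)) *: (\sum_i X i (u i)) =
  \sum_i \sum_a p i a *: X i a.
Proof.
under eq_bigr do rewrite scaler_sumr.
rewrite exchange_big/=; apply: eq_bigr => i _.
transitivity (\sum_(u : {ffun I -> A}) \sum_a
    ((\prod_k p k (u k)) * (u i == a)%:R) *: X i a).
  apply: eq_bigr => u _; rewrite (bigD1 (u i))//= eqxx mulr1.
  rewrite [X in _ + X]big1 ?addr0// => a.
  by rewrite eq_sym => /negbTE ->; rewrite mulr0 scale0r.
rewrite exchange_big/=; apply: eq_bigr => a _; rewrite -scaler_suml.
rewrite (indep_marginal (fun b => (b == a)%:R)) (bigD1 a)//= eqxx mulr1.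
rewrite [X in _ + X]big1 ?addr0//.
by move=> b /negbTE ->; rewrite mulr0.
Qed.

Lemma indep_cross (g h : A -> R) i j : i != j ->
  \sum_(u : {ffun I -> A}) (\prod_k p k (u k)) * (g (u i) * h (u j)) =
  (\sum_a p i a * g a) * (\sum_a p j a * h a).
Proof.
move=> ij; have ji : j != i by rewrite eq_sym.
under eq_bigr do rewrite (prod_at g) (prod_at h) -!big_split /=.
rewrite -(bigA_distr_bigA (fun k a => p k a * ((if k == i then g a else 1)
  * (if k == j then h a else 1)))).
rewrite (bigD1 i)//= (bigD1 j)//= !eqxx (negbTE ij) (negbTE ji) mulrA.
rewrite [X in _ * X]big1 ?mulr1.
  by congr (_ * _); apply: eq_bigr => a _; rewrite ?mulr1 ?mul1r.
move=> k /andP[/negbTE -> /negbTE ->].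
by under eq_bigr do rewrite !mulr1.
Qed.

Let mu (x : I -> A -> R) i := \sum_a p i a * x i a.

Let indep_sumr_sqr (x : I -> A -> R) (c : R) :
  \sum_(u : {ffun I -> A}) (\prod_i p i (u i)) * (c + \sum_i x i (u i)) ^+ 2 =
  (c + \sum_i mu x i) ^+ 2 + \sum_i \sum_a p i a * (x i a - mu x i) ^+ 2.
Proof.
pose y i a := x i a - mu x i.
have y0 i : \sum_a p i a * y i a = 0.
  rewrite /y; under eq_bigr do rewrite mulrBr.
  by rewrite sumrB -mulr_suml p1 mul1r subrr.
set C := c + \sum_i mu x i.
transitivity (\sum_(u : {ffun I -> A}) (\prod_i p i (u i) * C ^+ 2
    + 2 * C * \sum_i (\prod_k p k (u k)) * y i (u i)
    + \sum_i \sum_j (\prod_k p k (u k)) * (y i (u i) * y j (u j)))).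
  apply: eq_bigr => u _.
  have -> : c + \sum_i x i (u i) = C + \sum_i y i (u i).
    by rewrite /C /y sumrB; ring.
  set P := \prod_i _; rewrite -mulr_sumr.
  under [X in _ = _ + X]eq_bigr do rewrite -mulr_sumr -mulr_sumr.
  by rewrite -mulr_sumr -mulr_suml; ring.
rewrite !big_split/= -mulr_suml indep_mass1 mul1r -mulr_sumr.
rewrite exchange_big/= [X in _ + _ * X + _]big1 ?mulr0 ?addr0; last first.
  by move=> i _; rewrite indep_marginal y0.
congr (_ + _); rewrite exchange_big/=; apply: eq_bigr => i _.
rewrite exchange_big/= (bigD1 i)//= [X in _ + X]big1 ?addr0.
  by under eq_bigr do rewrite -expr2; rewrite (indep_marginal (fun a => y i a ^+ 2)).
by move=> j ji; rewrite indep_cross 1?eq_sym// y0 mul0r.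
Qed.

(** The variance of a sum of independent vectors is the sum of the variances;
    a constant summand only shifts the mean. *)
Lemma indep_sum_sqr d (X : I -> A -> 'rV[R]_d) (m : I -> 'rV[R]_d) (c : 'rV[R]_d) :
  (forall i, \sum_a p i a *: X i a = m i) ->
  \sum_(u : {ffun I -> A}) (\prod_i p i (u i)) * norm2 (c + \sum_i X i (u i)) ^+ 2 =
  norm2 (c + \sum_i m i) ^+ 2 + \sum_i \sum_a p i a * norm2 (X i a - m i) ^+ 2.
Proof.
move=> Xm.
have mE i j : m i 0 j = \sum_a p i a * X i a 0 j.
  by rewrite -Xm summxE; apply: eq_bigr => a _; rewrite mxE.
under eq_bigr do rewrite norm2_sqr mulr_sumr.
rewrite exchange_big/= norm2_sqr.
under [X in _ = _ + X]eq_bigr do under eq_bigr do rewrite norm2_sqr mulr_sumr.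
under [X in _ = _ + X]eq_bigr do rewrite exchange_big/=.
rewrite [X in _ = _ + X]exchange_big -big_split/=; apply: eq_bigr => j _.
transitivity (\sum_(u : {ffun I -> A}) (\prod_i p i (u i)) *
    (c 0 j + \sum_i X i (u i) 0 j) ^+ 2).
  by apply: eq_bigr => u _; rewrite !mxE summxE expr2.
rewrite (indep_sumr_sqr (fun i a => X i a 0 j)).
rewrite !mxE summxE -expr2; congr (_ + _).
  by congr ((_ + _) ^+ 2); apply: eq_bigr => i _; rewrite mE.
apply: eq_bigr => i _; apply: eq_bigr => a _.
by rewrite !mxE expr2 mE.
Qed.

End IndependentFamily.

Lemma variance_le_moment {R : realType} {A : finType} d (p : A -> R)
    (X : A -> 'rV[R]_d) (m : 'rV[R]_d) :
  \sum_a p a = 1 -> \sum_a p a *: X a = m ->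
  \sum_a p a * norm2 (X a - m) ^+ 2 <= \sum_a p a * norm2 (X a) ^+ 2.
Proof.
move=> p1 Xm.
rewrite -subr_ge0 -sumrB.
suff -> : \sum_a (p a * norm2 (X a) ^+ 2 - p a * norm2 (X a - m) ^+ 2) = dotv m m.
  exact: dotv_ge0.
transitivity (\sum_a (2 * dotv (p a *: X a) m - p a * dotv m m)).
  apply: eq_bigr => a _.
  by rewrite !norm2_sqr !(dotvDl, dotvDr, dotvNl, dotvNr, dotvZl) (dotvC m); ring.
by rewrite sumrB -mulr_sumr -dotv_suml Xm -mulr_suml p1; ring.
Qed.

Section UniformSamples.
Context {R : realType} {d n b : nat}.
Hypotheses (n0 : (0 < n)%N) (b0 : (0 < b)%N).
Implicit Types (Y : 'I_n -> 'rV[R]_d) (a : {ffun 'I_b -> 'I_n}).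

Let nR : n%:R != 0 :> R. Proof. by rewrite pnatr_eq0 -lt0n. Qed.

Let bR : 0 < b%:R :> R. Proof. by rewrite ltr0n. Qed.

Lemma uniform_mass1 : \sum_(j < n) (n%:R^-1 : R) = 1.
Proof. by rewrite sumr_const card_ord -[_ *+ n]mulr_natl mulfV. Qed.

Definition full_avg Y : 'rV[R]_d := n%:R^-1 *: \sum_j Y j.

Definition sample_avg Y a : 'rV[R]_d := b%:R^-1 *: \sum_i Y (a i).

Lemma sample_avg_mean Y :
  \sum_a (\prod_(i < b) n%:R^-1) *: sample_avg Y a = full_avg Y.
Proof.
under eq_bigr do rewrite scalerA mulrC -scalerA.
rewrite -scaler_sumr (indep_mean (fun=> uniform_mass1) (fun _ => Y)) -scaler_sumr.
rewrite sumr_const card_ord -[(_ *: _) *+ b]scaler_nat scalerK//.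
exact: lt0r_neq0.
Qed.

(** Averaging [b] independent samples divides the variance of one sample by
    [b], and that variance is at most the second moment. *)
Lemma sample_avg_variance Y (B : R) : (forall j, norm2 (Y j) <= B) ->
  \sum_a (\prod_(i < b) n%:R^-1) * norm2 (sample_avg Y a - full_avg Y) ^+ 2 <=
  B ^+ 2 / b%:R.
Proof.
move=> YB.
have mm (i : 'I_b) : \sum_j n%:R^-1 *: (b%:R^-1 *: Y j) = b%:R^-1 *: full_avg Y.
  by rewrite /full_avg scalerA mulrC -scalerA !scaler_sumr.
under eq_bigr do rewrite addrC /sample_avg scaler_sumr.
rewrite (indep_sum_sqr (fun=> uniform_mass1) (- full_avg Y) mm).
rewrite sumr_const card_ord -[(_ *: _) *+ b]scaler_nat scalerKV ?lt0r_neq0//.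
rewrite addNr norm2_sqr dotv00 add0r.
apply: (@le_trans _ _ (\sum_(i < b) b%:R^-1 * (B ^+ 2 / b%:R))); last first.
  rewrite -mulr_sumr sumr_const card_ord -[(_ / _) *+ b]mulr_natl mulKf//.
  exact: lt0r_neq0.
apply: ler_sum => i _; under eq_bigr do rewrite -scalerBr norm2Z exprMn mulrCA.
rewrite -mulr_sumr gtr0_norm ?invr_gt0// expr2 -mulrA ler_wpM2l ?invr_ge0//.
rewrite mulrC ler_wpM2r ?invr_ge0//.
apply: (le_trans (variance_le_moment uniform_mass1 _)).
  by rewrite /full_avg scaler_sumr.
apply: (@le_trans _ _ (\sum_(j < n) n%:R^-1 * B ^+ 2)); last first.
  by rewrite -mulr_suml uniform_mass1 mul1r.
apply: ler_sum => j _; rewrite ler_wpM2l ?invr_ge0// lerXn2r ?nnegrE ?norm2_ge0//.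
exact: le_trans (norm2_ge0 _) (YB j).
Qed.

Lemma normv_sample_avg Y (B : R) a :
  (forall j, `|Y j| <= B) -> `|sample_avg Y a| <= B.
Proof.
move=> YB; rewrite normrZ ger0_norm ?invr_ge0// mulrC ler_pdivrMr//.
apply: (le_trans (ler_norm_sum _ _ _)).
by rewrite mulr_natr -[X in _ *+ X]card_ord -sumr_const; apply: ler_sum.
Qed.

End UniformSamples.

(** * Finite expectations over histories *)

Section FiniteSupport.
Context {R : realType} {disp : measure_display} {Omega : measurableType disp}.
Context (P : probability Omega R) {W : countType} (H : Omega -> W).
Hypothesis mH : forall w, measurable [set om | H om = w].

Lemma countable_valued_measurable (F : W -> R) :
  measurable_fun setT (F \o H).
Proof.
move=> _ B mB; rewrite setTI.
have -> : (F \o H) @^-1` B =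
    \bigcup_w (if F w \in B then [set om | H om = w] else set0).
  apply/seteqP; split=> [om /= FB|om [w _]].
    by exists (H om) => //; rewrite ifT// inE.
  by case: ifP => // /set_mem FB /= Hw; rewrite Hw.
apply: countable_bigcupT_measurable; first exact: countableP.
by move=> w; case: ifP.
Qed.

(** The values in [s] have total probability one, so the variable is almost
    surely equal to a combination of indicators. *)
Lemma expectation_finite_support (s : seq W) (c F : W -> R) :
  uniq s -> {in s, forall w, P [set om | H om = w] = (c w)%:E} ->
  \sum_(w <- s) c w = 1 ->
  'E_P[F \o H]%E = (\sum_(w <- s) c w * F w)%:E.
Proof.
move=> us Pc c1; pose A w := [set om | H om = w].
pose g om := \sum_(w <- s) F w * \1_(A w) om.
have mA w : measurable (A w) by exact: mH.
have iA w : P.-integrable setT (fun om => (\1_(A w) om)%:E).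
  exact: integrable_indic.
have gE om : (g om)%:E = (\sum_(w <- s) (F w)%:E * (\1_(A w) om)%:E)%E.
  by rewrite /g -sumEFin.
have ig : (\int[P]_om (g om)%:E = (\sum_(w <- s) c w * F w)%:E)%E.
  under eq_integral do rewrite gE.
  rewrite integral_sum//; last by move=> w; exact: integrableZl.
  rewrite -sumEFin !big_seq; apply: eq_bigr => w ws.
  rewrite integralZl// integral_indic// setIT muleC EFinM; congr (_ * _)%E.
  exact: Pc.
rewrite unlock -ig; apply: ae_eq_integral => //.
- by apply/measurable_EFinP; exact: countable_valued_measurable.
- apply/measurable_EFinP; apply: measurable_sum => w.
  by apply: measurable_funM => //; exact: measurable_indic.
pose U := \bigcup_(w in [set` s]) A w.
have mU : measurable U by apply: fin_bigcup_measurable => //; exact: finite_seq.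
have PU : P U = 1%E.
  rewrite (measure_fin_bigcup P (finite_seq s) _ (fun w _ => mA w)); last first.
    apply/trivIsetP => w w' _ _ ww'; apply/seteqP; split=> // om [Hw Hw'].
    by move: ww'; rewrite -(Hw : H om = w) -(Hw' : H om = w') eqxx.
  rewrite -fsbig_seq// big_seq (eq_bigr (fun w => (c w)%:E)) => [|w ws].
    by rewrite -big_seq sumEFin c1.
  exact: Pc.
exists (~` U); split; first exact: measurableC.
  by rewrite [LHS](probability_setC P mU) PU subee.
move=> om /= nE [w /= ws Hw]; apply: nE => _; congr (_%:E).
rewrite /g (bigD1_seq w)//= big1 ?addr0.
  by rewrite indicE mem_set// mulr1 Hw.
move=> w' w'w; rewrite indicE memNset ?mulr0// /A/= Hw => ww'.
by rewrite ww' eqxx in w'w.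
Qed.

End FiniteSupport.

Section RandomHistories.
Context {R : realType} {W : countType}.
Variables (q : seq W -> W -> R) (supp : nat -> seq W).

(** [q h w] is the conditional probability of the next draw [w] given the
    history [h], latest draw first, and [supp t] lists the values that a draw
    can take after [t] earlier ones. *)
Fixpoint hist_prob (h : seq W) : R :=
  if h is w :: h' then hist_prob h' * q h' w else 1.

Fixpoint hists (t : nat) : seq (seq W) :=
  if t is t'.+1 then [seq w :: h | h <- hists t', w <- supp t'] else [:: [::]].

Definition hist_expect t (F : seq W -> R) : R :=
  \sum_(h <- hists t) hist_prob h * F h.

Lemma size_hists t h : h \in hists t -> size h = t.
Proof.
elim: t h => [|t IH] h /=; first by rewrite inE => /eqP ->.
by move=> /allpairsP[[h' w] [/= /IH <- _ ->]].
Qed.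

(** The tower property: the last draw is averaged given the earlier ones. *)
Lemma hist_expectS t F : hist_expect t.+1 F =
  hist_expect t (fun h => \sum_(w <- supp t) q h w * F (w :: h)).
Proof.
rewrite /hist_expect /= big_allpairs_dep/=; apply: eq_bigr => h _.
by rewrite mulr_sumr; apply: eq_bigr => w _; rewrite mulrA.
Qed.

Lemma hist_expectD t F G :
  hist_expect t (fun h => F h + G h) = hist_expect t F + hist_expect t G.
Proof. by rewrite -big_split; apply: eq_bigr => h _; rewrite /= mulrDr. Qed.

Lemma hist_expectZ t a F :
  hist_expect t (fun h => a * F h) = a * hist_expect t F.
Proof. by rewrite [RHS]mulr_sumr; apply: eq_bigr => h _; rewrite mulrCA. Qed.

Section KernelProbability.
Hypothesis q0 : forall h w, 0 <= q h w.

Lemma hist_prob_ge0 h : 0 <= hist_prob h.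
Proof. by elim: h => //= w h IH; rewrite mulr_ge0. Qed.

Lemma hist_expect_le t F G : (forall h, size h = t -> F h <= G h) ->
  hist_expect t F <= hist_expect t G.
Proof.
move=> FG; rewrite /hist_expect !big_seq; apply: ler_sum => h /size_hists ht.
by rewrite ler_wpM2l ?hist_prob_ge0 ?FG.
Qed.

Variable T : nat.
Hypothesis q1 : forall h, (size h < T)%N -> \sum_(w <- supp (size h)) q h w = 1.

Lemma hist_expect_cst t a : (t <= T)%N -> hist_expect t (fun=> a) = a.
Proof.
elim: t => [|t IH] tT; first by rewrite /hist_expect big_seq1 mul1r.
rewrite hist_expectS -[RHS]IH 1?ltnW//; rewrite /hist_expect !big_seq.
apply: eq_bigr => h /size_hists ht; congr (_ * _).
by rewrite -mulr_suml -ht q1 ?ht// mul1r.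
Qed.

Lemma hist_expect_behead t F : (t < T)%N ->
  hist_expect t.+1 (fun h => F (behead h)) = hist_expect t F.
Proof.
move=> tT; rewrite hist_expectS; apply: eq_big_seq => h /size_hists ht.
by congr (_ * _); rewrite /= -mulr_suml -ht q1 ?ht// mul1r.
Qed.

(** Jensen's inequality for the square root, from the nonnegativity of the
    variance of [F]. *)
Lemma hist_expect_le_sqrt t F : (t <= T)%N ->
  hist_expect t F <= Num.sqrt (hist_expect t (fun h => F h ^+ 2)).
Proof.
move=> tT; set m := hist_expect t F.
have : 0 <= hist_expect t (fun h => (F h - m) ^+ 2).
  rewrite -[leLHS](@hist_expect_cst t)//; apply: hist_expect_le => h _.
  exact: sqr_ge0.
have -> : (fun h => (F h - m) ^+ 2) =
    (fun h => F h ^+ 2 + ((- 2 * m) * F h + m ^+ 2)).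
  by apply/funext => h; ring.
rewrite !hist_expectD hist_expectZ hist_expect_cst// -/m => v0.
by apply: (le_trans (ler_norm m)); rewrite -sqrtr_sqr ler_wsqrtr//; lra.
Qed.

Section Run.
Context {disp : measure_display} {Omega : measurableType disp}.
Context (P : probability Omega R) (xi : nat -> Omega -> W).
Hypothesis supp_uniq : forall t, uniq (supp t).

Let hist t om := [seq xi s om | s <- rev (iota 1 t)].

Hypothesis xi_meas : forall t w, (1 <= t <= T)%N ->
  measurable [set om | xi t om = w].
Hypothesis xi_law : forall h w, (size h < T)%N ->
  P [set om | hist (size h).+1 om = w :: h] =
  (P [set om | hist (size h) om = h] * (q h w)%:E)%E.

Let histS t om : hist t.+1 om = xi t.+1 om :: hist t om.
Proof. by rewrite /hist -[in LHS](addn1 t) iotaD rev_cat/= add1n. Qed.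

Let hist_meas t h : (t <= T)%N -> measurable [set om | hist t om = h].
Proof.
elim: t h => [|t IH] h tT.
  have [->|h0] := eqVneq h [::].
    by rewrite (_ : [set _ | _] = setT)//; apply/seteqP; split.
  by rewrite (_ : [set _ | _] = set0)//; apply/seteqP; split=> // om /= /esym/eqP;
    rewrite (negbTE h0).
case: h => [|w h].
  rewrite (_ : [set _ | _] = set0)//.
  by apply/seteqP; split=> // om /=; rewrite histS.
have -> : [set om | hist t.+1 om = w :: h] =
    [set om | xi t.+1 om = w] `&` [set om | hist t om = h].
  apply/seteqP; split=> om /=; rewrite histS; first by case.
  by case=> -> ->.
by apply: measurableI; [exact: xi_meas|apply: IH; exact: ltnW].
Qed.

Let hist_law h : (size h <= T)%N ->
  P [set om | hist (size h) om = h] = (hist_prob h)%:E.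
Proof.
elim: h => [|w h IH] hT.
  rewrite (_ : [set _ | _] = setT) ?probability_setT//.
  by apply/seteqP; split.
by rewrite xi_law// IH 1?ltnW// -EFinM.
Qed.

Let hists_uniq t : uniq (hists t).
Proof.
elim: t => //= t IH; apply: allpairs_uniq => // -[h w] [h' w'] _ _ /=.
by case=> -> ->.
Qed.

(** Iterating the conditional laws gives each history [h] the probability
    [hist_prob h], and the listed histories exhaust the total mass. *)
Lemma expectation_history F t : (t <= T)%N ->
  'E_P[fun om => F (hist t om)]%E = (hist_expect t F)%:E.
Proof.
move=> tT.
apply: (@expectation_finite_support _ _ _ P _ (hist t) _ (hists t) hist_prob F).
- by move=> h; exact: hist_meas.
- exact: hists_uniq.
- by move=> h /size_hists ht; rewrite -[X in hist X]ht hist_law ?ht.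
- have := hist_expect_cst 1 tT; rewrite /hist_expect.
  by under eq_bigr do rewrite mulr1.
Qed.

End Run.
End KernelProbability.
End RandomHistories.

(** * The encoding scheme and one round of communication *)

Section Roundup.
Context {R : realType}.
Implicit Type r : R.

Lemma roundup_gt0 r : (0 < roundup r)%N.
Proof. by rewrite /roundup leq_max. Qed.

Lemma roundup_ge r : r <= (roundup r)%:R.
Proof.
apply: (@le_trans _ _ (`|Num.ceil r|%N)%:R); last by rewrite ler_nat leq_maxr.
apply: (le_trans (Num.Theory.ceil_ge r)).
by rewrite -[X in _ <= X]/(`|Num.ceil r|%N%:~R) ler_int abszE ler_norm.
Qed.

Lemma roundup_sqrt_sqr r : 0 <= r -> r <= (roundup (Num.sqrt r))%:R ^+ 2.
Proof.
move=> r0; rewrite -[leLHS]sqr_sqrtr// lerXn2r ?nnegrE ?sqrtr_ge0//.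
exact: roundup_ge.
Qed.

End Roundup.

Section Encoding.
Context {R : realType} {d : nat}.
Variable s : nat.
Hypothesis s0 : (0 < s)%N.
Implicit Types (g c : 'rV[R]_d) (i : 'I_d) (b : bool) (up : {ffun 'I_d -> bool}).

Let sR : 0 < s%:R :> R. Proof. by rewrite ltr0n. Qed.

Lemma enc_prob_ge0 g i b : 0 <= enc_prob s g i b.
Proof.
have [_] := enc_idxP g i s0; rewrite ler_pdivrMr// ler_pdivlMr// -natr1.
by rewrite /enc_prob; case: b => /andP[]; set r := _ * s%:R; set l := _%:R => *; lra.
Qed.

Lemma enc_prob_sum1 g i : \sum_b enc_prob s g i b = 1.
Proof. by rewrite big_bool /enc_prob /=; ring. Qed.

Let dec_coord g i b : R := Num.sg (g 0 i) * ((enc_idx s g i + b)%:R / s%:R) * `|g|.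

Let decodeE g up : Defs.decode s g up = \sum_i dec_coord g i (up i) *: delta_mx 0 i.
Proof.
by rewrite [LHS]row_sum_delta; apply: eq_bigr => i _; rewrite mxE.
Qed.

(* Division by [`|g|] is harmless at [g = 0], where both sides vanish. *)
Let coordE g i : g 0 i = Num.sg (g 0 i) * (`|g 0 i| / `|g|) * `|g|.
Proof.
have [g0|g0] := eqVneq `|g| 0; last by rewrite -mulrA divfK// -numEsg.
by rewrite g0 mulr0; apply/eqP; rewrite -normr_le0 -g0 le_abs_coord.
Qed.

Let dec_coord_mean g i : \sum_b enc_prob s g i b * dec_coord g i b = g 0 i.
Proof.
rewrite [RHS]coordE big_bool /enc_prob /dec_coord/= natrD addn0.
set r := `|g 0 i| / _; set l := (enc_idx s g i)%:R; field.
by rewrite gt_eqF.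
Qed.

Let dec_coord_err g i b : (dec_coord g i b - g 0 i) ^+ 2 <= `|g| ^+ 2 / s%:R ^+ 2.
Proof.
rewrite [X in dec_coord g i b - X]coordE /dec_coord -mulrBl -mulrBr.
have [_] := enc_idxP g i s0; rewrite natrD -natr1.
set r := `|g 0 i| / _; set l := (enc_idx s g i)%:R; rewrite !mulrDl => /andP[h1 h2].
move: h1 h2; set z := s%:R^-1; rewrite mul1r => h1 h2.
have w1 : `|l * z + (nat_of_bool b)%:R * z - r| <= z.
  rewrite ler_norml; have z0 : 0 < z by rewrite invr_gt0.
  by case: b => /=; rewrite ?mul1r ?mul0r; lra.
rewrite !exprMn mulrC ler_wpM2l ?sqr_ge0// -[leRHS]mul1r ler_pM ?sqr_ge0//.
  by rewrite sqr_sg lern1 leq_b1.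
by rewrite -[leLHS]real_normK ?num_real// -exprVn lerXn2r ?nnegrE// invr_ge0.
Qed.

Lemma decode_mean g :
  \sum_(up : {ffun 'I_d -> bool})
    (\prod_i enc_prob s g i (up i)) *: Defs.decode s g up = g.
Proof.
under eq_bigr do rewrite decodeE.
rewrite (indep_mean (enc_prob_sum1 g) (fun i b => dec_coord g i b *: 'e_i)).
rewrite [RHS]row_sum_delta; apply: eq_bigr => i _.
by under eq_bigr do rewrite scalerA; rewrite -scaler_suml dec_coord_mean.
Qed.

(** Coordinates are rounded independently and each one moves by at most
    [|g| / s]. *)
Lemma decode_sqr g c :
  \sum_(up : {ffun 'I_d -> bool})
    (\prod_i enc_prob s g i (up i)) * norm2 (c + Defs.decode s g up) ^+ 2 <=
  norm2 (c + g) ^+ 2 + d%:R * `|g| ^+ 2 / s%:R ^+ 2.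
Proof.
under eq_bigr do rewrite decodeE.
have m i : \sum_b enc_prob s g i b *: (dec_coord g i b *: 'e_i) =
    g 0 i *: 'e_i :> 'rV[R]_d.
  by under eq_bigr do rewrite scalerA; rewrite -scaler_suml dec_coord_mean.
rewrite (indep_sum_sqr (enc_prob_sum1 g) c m) -row_sum_delta lerD2l.
apply: (@le_trans _ _ (\sum_(i < d) `|g| ^+ 2 / s%:R ^+ 2)); last first.
  by rewrite sumr_const card_ord -mulrA mulr_natl.
apply: ler_sum => i _.
apply: (@le_trans _ _ (\sum_b enc_prob s g i b * (`|g| ^+ 2 / s%:R ^+ 2))); last first.
  by rewrite -mulr_suml enc_prob_sum1 mul1r.
apply: ler_sum => b _; rewrite ler_wpM2l ?enc_prob_ge0//.
rewrite -scalerBl norm2Z exprMn real_normK ?num_real//.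
suff -> : norm2 ('e_i : 'rV[R]_d) ^+ 2 = 1 by rewrite mulr1 dec_coord_err.
rewrite norm2_sqr /dotv (bigD1 i)//= big1 ?addr0; first by rewrite !mxE !eqxx mulr1.
by move=> j /negbTE ji; rewrite !mxE ji andbF mulr0.
Qed.

Lemma decode_variance g :
  \sum_(up : {ffun 'I_d -> bool})
    (\prod_i enc_prob s g i (up i)) * norm2 (Defs.decode s g up - g) ^+ 2 <=
  d%:R * `|g| ^+ 2 / s%:R ^+ 2.
Proof.
under eq_bigr do rewrite addrC.
by apply: (le_trans (decode_sqr _ _)); rewrite addNr norm2_sqr dotv00 add0r.
Qed.

Lemma normv_decode g up : `|Defs.decode s g up| <= `|g|.
Proof.
rewrite [leLHS]/Num.norm /= mx_normrE.
apply/bigmax_leP; split=> //= -[i j] _ /=; rewrite mxE 2!normrM normr_id.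
rewrite ler_piMl// mulr_ile1//; first by rewrite normr_sg lern1 leq_b1.
have [ls _] := enc_idxP g j s0.
rewrite ger0_norm ?divr_ge0// ler_pdivrMr// mul1r ler_nat.
by rewrite (leq_trans _ ls)// -addn1 leq_add2l leq_b1.
Qed.

End Encoding.

Section Communication.
Context {R : realType} {d M : nat} {A : finType}.
Variables (s1 s2 : nat) (p : A -> R) (X : 'I_M -> A -> 'rV[R]_d).
Variables (mu : 'I_M -> 'rV[R]_d) (B V : R).
Hypotheses (s10 : (0 < s1)%N) (s20 : (0 < s2)%N) (M0 : (0 < M)%N).
Hypotheses (p0 : forall a, 0 <= p a) (p1 : \sum_a p a = 1).
Hypothesis X_mean : forall m, \sum_a p a *: X m a = mu m.
Hypothesis X_var : forall m, \sum_a p a * norm2 (X m a - mu m) ^+ 2 <= V.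
Hypothesis X_bound : forall m a, `|X m a| <= B.

(** [A] describes what a worker samples, and [X m] the vector that worker [m]
    then encodes; the master encodes the average of what it decodes. *)
Definition received (S : {ffun 'I_M -> A})
    (u : {ffun 'I_M -> {ffun 'I_d -> bool}}) : 'rV[R]_d :=
  M%:R^-1 *: \sum_m Defs.decode s1 (X m (S m)) (u m).

Let MR : 0 < M%:R :> R. Proof. by rewrite ltr0n. Qed.

Let B0 (S : {ffun 'I_M -> A}) : 0 <= B.
Proof. exact: le_trans (normr_ge0 _) (X_bound (Ordinal M0) (S (Ordinal M0))). Qed.

Let avg_cst (x : R) : \sum_(m < M) M%:R^-1 * x = x.
Proof.
by rewrite -mulr_sumr sumr_const card_ord -[x *+ M]mulr_natl mulKf// lt0r_neq0.
Qed.

Lemma normv_received S u : `|received S u| <= B.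
Proof.
rewrite normrZ gtr0_norm ?invr_gt0// mulrC ler_pdivrMr//.
apply: (le_trans (ler_norm_sum _ _ _)).
rewrite mulr_natr -[X in _ *+ X]card_ord -sumr_const; apply: ler_sum => m _.
by apply: le_trans (X_bound m (S m)); exact: normv_decode.
Qed.

(** The three sources of randomness are revealed one after the other: the
    samples [S], the workers' rounding bits [u] and the master's rounding bits
    [v].  Given the earlier ones each source is unbiased, so removing them from
    the last to the first only adds variances.  Averaging over the workers
    divides the first two variances by [M]; the third one is not reduced, and
    is controlled because an average of decoded vectors is still bounded
    by [B]. *)
Lemma communication_sqr (c : 'rV[R]_d) :
  \sum_(S : {ffun 'I_M -> A}) (\prod_m p (S m)) *
  \sum_(u : {ffun 'I_M -> {ffun 'I_d -> bool}})
    (\prod_m \prod_i enc_prob s1 (X m (S m)) i (u m i)) *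
  \sum_(v : {ffun 'I_d -> bool})
    (\prod_i enc_prob s2 (received S u) i (v i)) *
    norm2 (c + Defs.decode s2 (received S u) v) ^+ 2 <=
  norm2 (c + M%:R^-1 *: \sum_m mu m) ^+ 2 +
  (V / M%:R + d%:R * B ^+ 2 / (M%:R * s1%:R ^+ 2) + d%:R * B ^+ 2 / s2%:R ^+ 2).
Proof.
set E2 := d%:R * B ^+ 2 / s2%:R ^+ 2.
set E1 := d%:R * B ^+ 2 / (M%:R * s1%:R ^+ 2).
have pS0 (S : {ffun 'I_M -> A}) : 0 <= \prod_m p (S m) by exact: prodr_ge0.
have pS1 : \sum_(S : {ffun 'I_M -> A}) \prod_m p (S m) = 1.
  exact: (indep_mass1 (fun=> p1)).
have pu1 (S : {ffun 'I_M -> A}) m :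
  \sum_(u : {ffun 'I_d -> bool}) \prod_i enc_prob s1 (X m (S m)) i (u i) = 1.
  exact: indep_mass1 (enc_prob_sum1 _ _).
have pU0 (S : {ffun 'I_M -> A}) (u : {ffun 'I_M -> {ffun 'I_d -> bool}}) :
    0 <= \prod_m \prod_i enc_prob s1 (X m (S m)) i (u m i).
  by apply: prodr_ge0 => m _; apply: prodr_ge0 => i _; exact: enc_prob_ge0.
have pU1 (S : {ffun 'I_M -> A}) : \sum_(u : {ffun 'I_M -> {ffun 'I_d -> bool}})
    \prod_m \prod_i enc_prob s1 (X m (S m)) i (u m i) = 1.
  exact: (indep_mass1 (pu1 S)).
apply: (@le_trans _ _ (\sum_(S : {ffun 'I_M -> A}) (\prod_m p (S m)) *
    (norm2 (c + \sum_m M%:R^-1 *: X m (S m)) ^+ 2 + (E1 + E2)))).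
  apply: ler_sum => S _; rewrite ler_wpM2l//.
  apply: (@le_trans _ _ (\sum_(u : {ffun 'I_M -> {ffun 'I_d -> bool}})
    (\prod_m \prod_i enc_prob s1 (X m (S m)) i (u m i)) *
    (norm2 (c + \sum_m M%:R^-1 *: Defs.decode s1 (X m (S m)) (u m)) ^+ 2 + E2))).
    apply: ler_sum => u _; rewrite ler_wpM2l//.
    apply: (le_trans (decode_sqr s20 _ _)).
    rewrite /received scaler_sumr lerD2l.
    rewrite ler_wpM2r ?invr_ge0 ?sqr_ge0// ler_wpM2l// lerXn2r ?nnegrE ?(B0 S)//.
    by rewrite -scaler_sumr; exact: normv_received.
  under eq_bigr do rewrite mulrDr.
  rewrite big_split/= -mulr_suml pU1 mul1r addrA lerD2r.
  have mm m : \sum_(u : {ffun 'I_d -> bool})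
      (\prod_i enc_prob s1 (X m (S m)) i (u i)) *:
      (M%:R^-1 *: Defs.decode s1 (X m (S m)) u) = M%:R^-1 *: X m (S m).
    under eq_bigr do rewrite scalerA mulrC -scalerA.
    by rewrite -scaler_sumr decode_mean.
  rewrite (indep_sum_sqr (pu1 S) c mm) lerD2l.
  apply: (@le_trans _ _ (\sum_(m < M) M%:R^-1 * E1)); last first.
    by rewrite avg_cst.
  apply: ler_sum => m _; under eq_bigr do rewrite -scalerBr norm2Z exprMn mulrCA.
  rewrite -mulr_sumr gtr0_norm ?invr_gt0// expr2 -mulrA ler_wpM2l ?invr_ge0//.
  apply: (@le_trans _ _ (M%:R^-1 * (d%:R * B ^+ 2 / s1%:R ^+ 2))).
    rewrite ler_wpM2l ?invr_ge0//; apply: (le_trans (decode_variance s10 _)).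
    by rewrite ler_wpM2r ?invr_ge0 ?sqr_ge0// ler_wpM2l// lerXn2r ?nnegrE ?(B0 S).
  by rewrite /E1 (invfM M%:R) [leLHS]mulrCA.
under eq_bigr do rewrite mulrDr.
rewrite big_split/= -mulr_suml pS1 mul1r -(addrA (V / _)) [leRHS]addrA lerD2r.
have mm m : \sum_a p a *: (M%:R^-1 *: X m a) = M%:R^-1 *: mu m.
  under eq_bigr do rewrite scalerA mulrC -scalerA.
  by rewrite -scaler_sumr X_mean.
rewrite (indep_sum_sqr (fun=> p1) c mm) -scaler_sumr lerD2l.
apply: (@le_trans _ _ (\sum_(m < M) M%:R^-1 * (V / M%:R))); last first.
  by rewrite avg_cst.
apply: ler_sum => m _; under eq_bigr do rewrite -scalerBr norm2Z exprMn mulrCA.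
rewrite -mulr_sumr gtr0_norm ?invr_gt0// expr2 -mulrA ler_wpM2l ?invr_ge0//.
by rewrite mulrC ler_wpM2r ?invr_ge0.
Qed.

End Communication.

(** * The law of one round *)

Section Draws.
Context {R : realType} {d M n : nat}.
Variables (f : 'I_M -> 'I_n -> 'rV[R]_d -> R) (x1 : 'rV[R]_d).
Variable prm : qfw_params R.
Variable lmo : seq (draw d M n) -> 'rV[R]_d -> 'rV[R]_d.
Hypotheses (n0 : (0 < n)%N).
Hypotheses (level1_gt0 : forall ik, (0 < level1 prm ik)%N)
  (level2_gt0 : forall ik, (0 < level2 prm ik)%N).

Local Notation run := (qfw f x1 prm lmo).
Local Notation index t := (round_index (period prm) t).
Local Notation kernel := (draw_prob f x1 prm lmo).

Definition coll_size (ik : nat * nat) : nat :=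
  if ik.2 == 1%N then n else batch prm ik.

(** The draws of a round that have positive probability lie in the image of a
    finite type, since the size of the collections is then fixed. *)
Definition sized_draw (b : nat) : finType :=
  ({ffun 'I_M -> {ffun 'I_b -> 'I_n}} * {ffun 'I_M -> {ffun 'I_d -> bool}}
   * {ffun 'I_d -> bool})%type.

Definition draw_of b (w : sized_draw b) : draw d M n :=
  ([ffun m => codom (w.1.1 m)], w.1.2, w.2).

Lemma draw_of_inj b : injective (@draw_of b).
Proof.
move=> [[S u] v] [[S' u'] v'] [/ffunP SS' -> ->]; congr (_, _, _).
apply/ffunP => m; apply/ffunP => i; move/(_ m): SS'; rewrite !ffunE !codomE.
by move=> /eq_in_map -> //; rewrite mem_enum.
Qed.

Definition round_draws (t : nat) : seq (draw d M n) :=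
  [seq draw_of w | w <- enum (sized_draw (coll_size (index t.+1)))].

Lemma round_draws_uniq t : uniq (round_draws t).
Proof. by rewrite map_inj_uniq ?enum_uniq//; exact: draw_of_inj. Qed.

Lemma sum_sized_draw b (F : draw d M n -> R) :
  \sum_(w : sized_draw b) F (draw_of w) =
  \sum_(S : {ffun 'I_M -> {ffun 'I_b -> 'I_n}})
  \sum_(u : {ffun 'I_M -> {ffun 'I_d -> bool}}) \sum_(v : {ffun 'I_d -> bool})
    F (draw_of (S, u, v)).
Proof.
rewrite pair_bigA pair_bigA /=.
by apply: eq_bigr => -[[S u] v] _.
Qed.

Lemma draw_prob_ge0 h w : 0 <= kernel h w.
Proof.
apply: mulr_ge0; first apply: mulr_ge0.
- apply: prodr_ge0 => m _; rewrite /coll_prob; case: ifP => _; first exact: ler0n.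
  by rewrite mulr_ge0// exprn_ge0// invr_ge0.
- by apply: prodr_ge0 => m _; apply: prodr_ge0 => c _; exact: enc_prob_ge0.
- by apply: prodr_ge0 => c _; exact: enc_prob_ge0.
Qed.

Definition coll_law ik (a : {ffun 'I_(coll_size ik) -> 'I_n}) : R :=
  coll_prob prm ik (codom a).

Lemma coll_law_ge0 ik a : 0 <= coll_law (ik := ik) a.
Proof.
rewrite /coll_law /coll_prob; case: ifP => _; first exact: ler0n.
by rewrite mulr_ge0// exprn_ge0// invr_ge0.
Qed.

(** In the first round of a period the law is a point mass: among the functions
    from ['I_n] to itself only the identity enumerates ['I_n] in order. *)
Lemma coll_law_full ik (V : lmodType R) (F : seq 'I_n -> V) : ik.2 = 1%N ->
  \sum_(a : {ffun 'I_(coll_size ik) -> 'I_n}) coll_law a *: F (codom a) =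
  F (enum 'I_n).
Proof.
move=> k1; rewrite /coll_law /coll_prob /coll_size k1 eqxx.
have cid : codom [ffun i : 'I_n => i] = enum 'I_n.
  by rewrite codomE -[RHS]map_id; apply: eq_map => i; rewrite ffunE.
rewrite (bigD1 [ffun i : 'I_n => i])//= cid eqxx scale1r big1 ?addr0// => a.
case: (eqVneq (codom a) (enum 'I_n)) => [ca|_ _]; last by rewrite scale0r.
move=> /eqP []; apply/ffunP => i; move: ca; rewrite -cid !codomE.
by move=> /eq_in_map -> //; rewrite mem_enum.
Qed.

Lemma coll_law_sampled ik (a : {ffun 'I_(coll_size ik) -> 'I_n}) : ik.2 <> 1%N ->
  coll_law a = \prod_(i < coll_size ik) (n%:R^-1 : R).
Proof.
move=> /eqP/negbTE k1; rewrite /coll_law /coll_prob size_codom card_ord k1.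
by rewrite prodr_const card_ord {1}/coll_size k1 eqxx mul1r.
Qed.

Lemma coll_law_sum1 ik : \sum_a coll_law (ik := ik) a = 1.
Proof.
have [k1|k1] := eqVneq ik.2 1%N.
  rewrite -(coll_law_full (fun=> 1 : R^o) k1).
  by apply: eq_bigr => a _; rewrite [RHS]mulr1.
rewrite -[RHS](@indep_mass1 _ 'I_(coll_size ik) _ _ (fun=> uniform_mass1 n0)).
by apply: eq_bigr => a _; rewrite coll_law_sampled//; exact/eqP.
Qed.

Definition worker_on (ik : nat * nat) (st : state) (m : 'I_M) (S : seq 'I_n) :
    'rV[R]_d :=
  let fS := avg_fun (f m) S in
  if ik.2 == 1%N then grad fS (cur st) else grad fS (cur st) - grad fS (prv st).

(** The law of a round, read in the order in which its randomness is revealed: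
    collections, then the workers' bits, then the master's bits. *)
Lemma draw_prob_sum h (F : draw d M n -> R) :
  let st := run h in let ik := index (size h).+1 in
  let X m (a : {ffun 'I_(coll_size ik) -> 'I_n}) := worker_on ik st m (codom a) in
  \sum_(w <- round_draws (size h)) kernel h w * F w =
  \sum_(S : {ffun 'I_M -> {ffun 'I_(coll_size ik) -> 'I_n}})
    (\prod_m coll_law (S m)) *
  \sum_(u : {ffun 'I_M -> {ffun 'I_d -> bool}})
    (\prod_m \prod_c enc_prob (level1 prm ik) (X m (S m)) c (u m c)) *
  \sum_(v : {ffun 'I_d -> bool})
    (\prod_c enc_prob (level2 prm ik) (received (level1 prm ik) X S u) c (v c)) *
    F (draw_of (S, u, v)).
Proof.
move=> st ik X.
have XE S u v m : worker_vec f ik st (draw_of (S, u, v)) m = X m (S m).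
  by rewrite /worker_vec /coll/= ffunE.
have mE S u v : master_vec f prm ik st (draw_of (S, u, v)) =
    received (level1 prm ik) X S u.
  rewrite /master_vec /received.
  apply: congr1.
  apply: eq_bigr => m _.
  rewrite (XE S u v m).
  by [].
have kE S u v : kernel h (draw_of (S, u, v)) = (\prod_m coll_law (S m)) *
    (\prod_m \prod_c enc_prob (level1 prm ik) (X m (S m)) c (u m c)) *
    \prod_c enc_prob (level2 prm ik) (received (level1 prm ik) X S u) c (v c).
  transitivity ((\prod_m coll_law (S m)) * (\prod_m \prod_c enc_prob (level1 prm ik)
      (worker_vec f ik st (draw_of (S, u, v)) m) c (u m c)) *
    \prod_c enc_prob (level2 prm ik) (master_vec f prm ik st (draw_of (S, u, v))) c (v c)).
    apply: (congr2 *%R _ erefl); apply: (congr2 *%R _ erefl).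
    by apply: eq_bigr => m _; rewrite /coll/= ffunE.
  rewrite (mE S u v); apply: (congr2 *%R _ erefl); apply: (congr2 *%R erefl).
  by apply: eq_bigr => m _; apply: eq_bigr => c _; rewrite (XE S u v m).
rewrite big_map big_enum/= (sum_sized_draw _ (fun w => kernel h w * F w)).
apply: eq_bigr => S _; rewrite [RHS]mulr_sumr; apply: eq_bigr => u _.
rewrite [RHS]mulrA [RHS]mulr_sumr; apply: eq_bigr => v _.
by rewrite kE [RHS]mulrA.
Qed.

Lemma draw_prob_sum1 h : \sum_(w <- round_draws (size h)) kernel h w = 1.
Proof.
have := draw_prob_sum h (fun=> 1); under eq_bigr do rewrite mulr1.
set ik := index _; move=> /= ->.
rewrite -[RHS](indep_mass1 (fun _ : 'I_M => coll_law_sum1 ik)).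
apply: eq_bigr => S _; rewrite -[RHS]mulr1; congr (_ * _).
have worker_mass1 m := indep_mass1 (enc_prob_sum1 (level1 prm ik)
  (worker_on ik (run h) m (codom (S m)))).
rewrite -[RHS](indep_mass1 worker_mass1); apply: eq_bigr => u _.
rewrite -[RHS]mulr1; congr (_ * _); under eq_bigr do rewrite mulr1.
exact: indep_mass1 (enc_prob_sum1 _ _).
Qed.

(** The mean square distance from the new estimate to a target [c] splits into
    the squared bias and the variances of the round.  In the first round of a
    period the previous estimate is discarded, whence the conditional. *)
Lemma estimate_sqr (M0 : (0 < M)%N) h (mu : 'I_M -> 'rV[R]_d) (B V : R) (c : 'rV[R]_d) :
  let st := run h in let ik := index (size h).+1 in
  let X m (a : {ffun 'I_(coll_size ik) -> 'I_n}) := worker_on ik st m (codom a) in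
  (forall m, \sum_a coll_law a *: X m a = mu m) ->
  (forall m, \sum_a coll_law a * norm2 (X m a - mu m) ^+ 2 <= V) ->
  (forall m a, `|X m a| <= B) ->
  \sum_(w <- round_draws (size h)) kernel h w *
    norm2 (estimate f prm ik st w - c) ^+ 2 <=
  norm2 ((if ik.2 == 1%N then 0 else est st) - c + M%:R^-1 *: \sum_m mu m) ^+ 2 +
  (V / M%:R + d%:R * B ^+ 2 / (M%:R * (level1 prm ik)%:R ^+ 2)
   + d%:R * B ^+ 2 / (level2 prm ik)%:R ^+ 2).
Proof.
move=> st ik X Xm Xv Xb; rewrite draw_prob_sum.
set c' := (if _ then _ else _) - c.
have := communication_sqr (level1_gt0 ik) (level2_gt0 ik) M0
  (@coll_law_ge0 ik) (coll_law_sum1 ik) Xm Xv Xb c'.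
congr (_ <= _); apply: eq_bigr => S _; congr (_ * _); apply: eq_bigr => u _.
congr (_ * _); apply: eq_bigr => v _; congr (_ * norm2 _ ^+ 2).
have mE : master_vec f prm ik st (draw_of (S, u, v)) =
    received (level1 prm ik) X S u.
  rewrite /master_vec /received; apply: congr1; apply: eq_bigr => m _.
  have XE : worker_vec f ik st (draw_of (S, u, v)) m = X m (S m).
    by rewrite /worker_vec /coll/= ffunE.
  by rewrite XE.
rewrite /estimate mE /c' /bits2/= addrC.
by case: ifP => _; rewrite ?add0r ?addrA ?addr0.
Qed.

End Draws.

(** * The doubling schedule *)

Section DoublingPeriods.

Let p (i : nat) : nat := (2 ^ i.-1)%N.

Let p_gt0 i : (0 < p i)%N. Proof. by rewrite expn_gt0. Qed.

(** Since [1 + 2 + ... + 2^(i-2) = 2^(i-1) - 1], a period of length [p] is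
    preceded by exactly [p - 1] rounds. *)
Lemma doubling_round t : (0 < t)%N ->
  [/\ t.+1 = (p (round_index p t).1 + (round_index p t).2)%N,
      (0 < (round_index p t).2)%N & ((round_index p t).2 <= p (round_index p t).1)%N].
Proof.
move=> t0; have [i0 tE /andP[k0 kp]] := round_indexP p_gt0 t0.
split=> //; rewrite [in LHS]tE -addSn; congr (_ + _)%N.
case: (round_index p t).1 i0 => // i _; rewrite /p /=.
elim: i => [|i IH]; first by rewrite big_geq.
by rewrite big_nat_recr//= -addSn IH expnS mul2n addnn.
Qed.

Lemma round_indexS t : (0 < t)%N ->
  round_index p t.+1 = next_round p (round_index p t).
Proof. by case: t. Qed.

End DoublingPeriods.

(** * Averages of smooth convex functions *)

Section Averages.
Context {R : realType} {d M n : nat}.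
Variable f : 'I_M -> 'I_n -> 'rV[R]_d -> R.

Lemma grad_avg_fun m b (a : {ffun 'I_b -> 'I_n}) x :
  (forall j, differentiable (f m j : _ -> R^o) x) ->
  grad (avg_fun (f m) (codom a)) x = sample_avg (fun j => grad (f m j) x) a.
Proof.
move=> df.
have -> : avg_fun (f m) (codom a) = (fun y => b%:R^-1 * \sum_i f m (a i) y).
  by apply/funext => y; rewrite /avg_fun size_codom card_ord codomE big_map big_enum.
exact: grad_sum.
Qed.

Lemma grad_avg_fun_full m x :
  (forall j, differentiable (f m j : _ -> R^o) x) ->
  grad (avg_fun (f m) (enum 'I_n)) x = full_avg (fun j => grad (f m j) x).
Proof.
move=> df.
have -> : avg_fun (f m) (enum 'I_n) = (fun y => n%:R^-1 * \sum_j f m j y).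
  by apply/funext => y; rewrite /avg_fun size_enum_ord big_enum.
exact: grad_sum.
Qed.

Lemma grad_objective x : (forall m j, differentiable (f m j : _ -> R^o) x) ->
  grad (objective f) x = M%:R^-1 *: \sum_m full_avg (fun j => grad (f m j) x).
Proof.
move=> df.
have -> : objective f = (fun y => M%:R^-1 * \sum_m (n%:R^-1 * \sum_j f m j y)).
  apply/funext => y; rewrite /objective natrM invfM -mulrA.
  by congr (_ * _); rewrite mulr_sumr.
rewrite grad_sum.
  by congr (_ *: _); apply: eq_bigr => m _; rewrite grad_sum.
move=> m.
have -> : (fun y => n%:R^-1 * \sum_j f m j y) =
    n%:R^-1 *: \sum_(j < n) (f m j : 'rV[R]_d -> R^o).
  by apply/funext => y; rewrite /GRing.scale/= fct_sumE.
by apply: differentiableZ; apply: differentiable_sum.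
Qed.

Let avg2 (c : 'I_M -> 'I_n -> R) : R := (M * n)%:R^-1 * \sum_m \sum_j c m j.

Let avg2_le c c' : (forall m j, c m j <= c' m j) -> avg2 c <= avg2 c'.
Proof.
move=> cc'; rewrite ler_wpM2l ?invr_ge0//.
by apply: ler_sum => m _; apply: ler_sum => j _; exact: cc'.
Qed.

Let avg2D c c' : avg2 (fun m j => c m j + c' m j) = avg2 c + avg2 c'.
Proof.
rewrite -mulrDr -big_split; congr (_ * _).
by apply: eq_bigr => m _; rewrite -big_split.
Qed.

Let avg2_cst e : (0 < M)%N -> (0 < n)%N -> avg2 (fun _ _ => e) = e.
Proof.
move=> M0 n0; rewrite /avg2 sumr_const sumr_const !card_ord -mulrnA [(n * M)%N]mulnC.
by rewrite -[e *+ _]mulr_natl mulKf// pnatr_eq0 -lt0n muln_gt0 M0 n0.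
Qed.

Let dotv_grad_objective x v : (forall m j, differentiable (f m j : _ -> R^o) x) ->
  dotv (grad (objective f) x) v = avg2 (fun m j => dotv (grad (f m j) x) v).
Proof.
move=> df; rewrite grad_objective// dotvZl dotv_suml /avg2 natrM invfM -mulrA.
congr (_ * _); rewrite mulr_sumr; apply: eq_bigr => m _.
by rewrite dotvZl dotv_suml.
Qed.

Variables (K : set 'rV[R]_d) (L : R).
Hypothesis smooth : forall m j, smooth_on K L (f m j).

Lemma objective_ge_tangent x y :
  (forall m j, convex_function K (f m j)) -> K x -> K y ->
  objective f x + dotv (grad (objective f) x) (y - x) <= objective f y.
Proof.
move=> cf Kx Ky; have df m j := (smooth m j).1 x Kx.
rewrite dotv_grad_objective// -avg2D; apply: avg2_le => m j.
exact: (convex_ge_tangent (cf m j)).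
Qed.

Lemma objective_le_quadratic x y : (0 < M)%N -> (0 < n)%N ->
  convex_set K -> K x -> K y ->
  objective f y <= objective f x + dotv (grad (objective f) x) (y - x)
    + L / 2 * norm2 (y - x) ^+ 2.
Proof.
move=> M0 n0 cK Kx Ky; have df m j := (smooth m j).1 x Kx.
rewrite dotv_grad_objective// -avg2D -[L / 2 * _]avg2_cst// -avg2D.
by apply: avg2_le => m j; exact: (smooth_le_quadratic cK).
Qed.

End Averages.

(** * Estimation error and convergence *)

Section QuantizedFrankWolfe.
Context {R : realType} {d M n : nat}.
Variables (K : set 'rV[R]_d) (f : 'I_M -> 'I_n -> 'rV[R]_d -> R) (L Ginf : R).
Variables (x1 xstar : 'rV[R]_d) (lmo : seq (draw d M n) -> 'rV[R]_d -> 'rV[R]_d).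
Hypotheses (M0 : (0 < M)%N) (n0 : (0 < n)%N).
Hypotheses (cK : convex_set K) (kK : compact K).
Hypothesis smooth : forall m j, smooth_on K L (f m j).
Hypothesis grad_bound : forall m j x, K x -> `|grad (f m j) x| <= Ginf.
Hypothesis Kx1 : K x1.
Hypothesis lmoP : is_lmo K lmo.

Local Notation prm := (qfw_schedule R d M).
Local Notation run := (qfw f x1 prm lmo).
Local Notation index t := (round_index (period prm) t).
Local Notation plen t := (period prm (index t).1).
Local Notation kernel := (draw_prob f x1 prm lmo).
Local Notation draws := (@round_draws R d M n prm).
Local Notation D := (diameter K).
Local Notation F := (objective f).

Let df m j x : K x -> differentiable (f m j : _ -> R^o) x.
Proof. exact: (smooth m j).1. Qed.

Lemma level1_gt0 ik : (0 < level1 prm ik)%N.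
Proof. by rewrite /=; case: ifP => _; exact: roundup_gt0. Qed.

Lemma level2_gt0 ik : (0 < level2 prm ik)%N.
Proof. by rewrite /=; case: ifP => _; exact: roundup_gt0. Qed.

Let plen_gt0 t : 0 < (plen t)%:R :> R.
Proof. by rewrite ltr0n /= expn_gt0. Qed.

Lemma stepsizeE t : (0 < t)%N -> stepsize prm (index t) = 2 / t.+1%:R.
Proof. by move=> t0; have [-> _ _] := doubling_round t0. Qed.

Lemma diameter_ge0 : 0 <= D.
Proof. exact: le_trans (norm2_ge0 (x1 - x1)) (norm2_le_diameter kK Kx1 Kx1). Qed.

Lemma cur_run w h : cur (run (w :: h)) = cur (run h) +
  2 / (size h).+2%:R *: (lmo (w :: h) (est (run (w :: h))) - cur (run h)).
Proof. by rewrite -(@stepsizeE (size h).+1). Qed.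

Lemma run_in_K h : K (cur (run h)) /\ K (prv (run h)).
Proof.
elim: h => // w h [IH _]; split=> //; rewrite cur_run.
apply: convex_set_step => //; last exact: (lmoP _ _).1.
by rewrite divr_ge0//= ler_pdivrMr// mul1r (ler_nat _ 2).
Qed.

Lemma run_step w h : norm2 (cur (run (w :: h)) - prv (run (w :: h))) <=
  2 / (size h).+2%:R * D.
Proof.
rewrite cur_run -[prv _]/(cur (run h)) [X in norm2 X]addrC addKr norm2Z.
rewrite ger0_norm ?divr_ge0// ler_wpM2l ?divr_ge0//.
by apply: norm2_le_diameter => //; [exact: (lmoP _ _).1|exact: (run_in_K h).1].
Qed.

Definition grad_error (h : seq (draw d M n)) : 'rV[R]_d :=
  est (run h) - grad F (prv (run h)).

Let plenR t : R := (plen t)%:R.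

(* The levels are chosen so that [d z <= s], where [s] is a squared level
   (times [M] for the workers) and [z] is [p^2] or [p]. *)
Let encoding_cost (q z s : R) : 0 <= q -> 0 < z -> 0 < s -> d%:R * z <= s ->
  d%:R * q / s <= q / z.
Proof.
move=> q0 z0 s0 dz; rewrite ler_pdivrMr// mulrAC ler_pdivlMr//.
by rewrite -mulrA mulrCA ler_wpM2l.
Qed.

Let natr_sqr_gt0 s : (0 < s)%N -> 0 < s%:R ^+ 2 :> R.
Proof. by move=> s0; rewrite exprn_gt0// ltr0n. Qed.

Let MR : 0 < M%:R :> R. Proof. by rewrite ltr0n. Qed.

Let level1_sqr ik : d%:R * ((period prm ik.1)%:R ^+ (if ik.2 == 1%N then 2 else 1)) <=
  M%:R * (level1 prm ik)%:R ^+ 2 :> R.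
Proof.
rewrite [leRHS]mulrC -ler_pdivrMr// /level1/=.
by case: ifP => _; rewrite ?expr1 roundup_sqrt_sqr// divr_ge0// mulr_ge0// ?exprn_ge0.
Qed.

Let level2_sqr ik : d%:R * ((period prm ik.1)%:R ^+ (if ik.2 == 1%N then 2 else 1)) <=
  (level2 prm ik)%:R ^+ 2 :> R.
Proof.
by rewrite /level2/=; case: ifP => _; rewrite ?expr1 roundup_sqrt_sqr// mulr_ge0// ?exprn_ge0.
Qed.

(** The workers use their exact local gradients, so only the two encodings
    contribute, each at most [Ginf^2 / p^2]. *)
Lemma grad_error_first (h : seq (draw d M n)) : (index (size h).+1).2 = 1%N ->
  \sum_(w <- draws (size h)) kernel h w * norm2 (grad_error (w :: h)) ^+ 2 <=
  2 * Ginf ^+ 2 / plenR (size h).+1 ^+ 2.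
Proof.
move=> k1; set ik := index (size h).+1; set st := run h.
have Kx : K (cur st) := (run_in_K h).1.
have worker1 m S : worker_on f ik st m S = grad (avg_fun (f m) S) (cur st).
  by rewrite /worker_on k1.
have := @estimate_sqr R d M n f x1 prm lmo n0 level1_gt0 level2_gt0 M0 h
  (fun m => worker_on f ik st m (enum 'I_n)) Ginf 0 (grad F (cur st)).
rewrite -/ik -/st => /(_ _ _ _)/le_trans; apply.
- by move=> m; exact: (coll_law_full prm (worker_on f ik st m) k1).
- move=> m.
  rewrite (coll_law_full prm (fun S => norm2 (worker_on f ik st m S -
    worker_on f ik st m (enum 'I_n)) ^+ 2 : R^o) k1).
  by rewrite subrr norm2_sqr dotv00.
- move=> m a; rewrite worker1 grad_avg_fun; last by move=> j; exact: df.
  by apply: normv_sample_avg => [|j]; [rewrite /coll_size k1|exact: grad_bound].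
have -> : M%:R^-1 *: \sum_m worker_on f ik st m (enum 'I_n) = grad F (cur st).
  rewrite grad_objective => [|m j]; last exact: df.
  apply: congr1; apply: eq_bigr => m _.
  by rewrite worker1 grad_avg_fun_full// => j; exact: df.
rewrite k1 eqxx sub0r addNr norm2_sqr dotv00 mul0r !add0r.
have -> : 2 * Ginf ^+ 2 / plenR (size h).+1 ^+ 2 =
  Ginf ^+ 2 / plenR (size h).+1 ^+ 2 + Ginf ^+ 2 / plenR (size h).+1 ^+ 2 by ring.
have P2 : 0 < plenR (size h).+1 ^+ 2 by rewrite exprn_gt0// plen_gt0.
have h1 := level1_sqr ik; have h2 := level2_sqr ik; rewrite k1 eqxx in h1 h2.
have l1 := natr_sqr_gt0 (level1_gt0 ik); have l2 := natr_sqr_gt0 (level2_gt0 ik).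
by apply: lerD; [exact: encoding_cost (sqr_ge0 _) P2 (mulr_gt0 MR l1) h1
  |exact: encoding_cost (sqr_ge0 _) P2 l2 h2].
Qed.

(** The increment estimates [grad F x_t - grad F x_(t-1)] without bias given
    the past, so the previous error is kept and only the variance of the
    increment is added: [B^2 / p] for each of sampling and the two encodings. *)
Lemma grad_error_next (h : seq (draw d M n)) B : (index (size h).+1).2 <> 1%N ->
  (forall m j, norm2 (grad (f m j) (cur (run h)) - grad (f m j) (prv (run h))) <= B) ->
  \sum_(w <- draws (size h)) kernel h w * norm2 (grad_error (w :: h)) ^+ 2 <=
  norm2 (grad_error h) ^+ 2 + 3 * B ^+ 2 / plenR (size h).+1.
Proof.
move=> k1 YB; set ik := index (size h).+1; set st := run h.
have [Kx Ky] := run_in_K h.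
pose Y m j := grad (f m j) (cur st) - grad (f m j) (prv st).
have k1b : (ik.2 == 1%N) = false by exact/eqP.
have b0 : (0 < @coll_size R n prm ik)%N by rewrite /coll_size k1b roundup_gt0.
have workerE m (a : {ffun 'I_(@coll_size R n prm ik) -> 'I_n}) :
    worker_on f ik st m (codom a) = sample_avg (Y m) a.
  rewrite /worker_on k1b !grad_avg_fun; try by move=> j; exact: df.
  by rewrite -scalerBr -sumrB.
have := @estimate_sqr R d M n f x1 prm lmo n0 level1_gt0 level2_gt0 M0 h
  (fun m => full_avg (Y m)) B (B ^+ 2 / (@coll_size R n prm ik)%:R) (grad F (cur st)).
rewrite -/ik -/st => /(_ _ _ _)/le_trans; apply.
- move=> m; rewrite -(sample_avg_mean n0 b0 (Y m)); apply: eq_bigr => a _.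
  by rewrite workerE coll_law_sampled.
- move=> m; apply: le_trans (sample_avg_variance n0 b0 (YB m)).
  by apply: ler_sum => a _; rewrite workerE coll_law_sampled.
- move=> m a; rewrite workerE; apply: normv_sample_avg => // j.
  exact: le_trans (normv_le_norm2 _) (YB m j).
have -> : M%:R^-1 *: \sum_m full_avg (Y m) = grad F (cur st) - grad F (prv st).
  rewrite !grad_objective; try by move=> m j; exact: df.
  rewrite -scalerBr -sumrB; apply: congr1; apply: eq_bigr => m _.
  by rewrite -scalerBr -sumrB.
rewrite k1b.
have -> : est st - grad F (cur st) + (grad F (cur st) - grad F (prv st)) =
    grad_error h.
  by rewrite addrA subrK.
rewrite lerD2l.
have P1 : 0 < plenR (size h).+1 := plen_gt0 _.
have h1 := level1_sqr ik; have h2 := level2_sqr ik; rewrite k1b !expr1 in h1 h2.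
have -> : 3 * B ^+ 2 / plenR (size h).+1 =
  B ^+ 2 / plenR (size h).+1 + B ^+ 2 / plenR (size h).+1 +
  B ^+ 2 / plenR (size h).+1 by ring.
have l1 := natr_sqr_gt0 (level1_gt0 ik); have l2 := natr_sqr_gt0 (level2_gt0 ik).
apply: lerD; last exact: encoding_cost (sqr_ge0 _) P1 l2 h2.
apply: lerD; last exact: encoding_cost (sqr_ge0 _) P1 (mulr_gt0 MR l1) h1.
have p0 : (0 < plen (size h).+1)%N by rewrite /= expn_gt0.
rewrite -mulrA ler_wpM2l ?sqr_ge0// -invfM lef_pV2 ?posrE ?mulr_gt0 ?ltr0n//.
rewrite -ler_pdivrMr// /coll_size k1b; exact: roundup_ge.
Qed.

Local Notation expect := (hist_expect kernel draws).

Let kernel_ge0 h w : 0 <= kernel h w.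
Proof. exact: (draw_prob_ge0 f x1 lmo level1_gt0 level2_gt0). Qed.

Let expect_le t A B : (forall h, size h = t -> A h <= B h) ->
  expect t A <= expect t B.
Proof. by apply: hist_expect_le => h w; exact: kernel_ge0. Qed.

Let kernel_sum1 T (h : seq (draw d M n)) : (size h < T)%N ->
  \sum_(w <- draws (size h)) kernel h w = 1.
Proof. by move=> _; exact: draw_prob_sum1. Qed.

Let expect_cst t a : expect t (fun=> a) = a.
Proof. exact: (hist_expect_cst (@kernel_sum1 t)). Qed.

(* Rounds are counted from 1, so a history of [t + 1] draws ends with round
   [t + 1]; the error of its [k]-th round carries [k - 1] increments. *)
Let grad_error_rec t :
  expect t.+1 (fun h => norm2 (grad_error h) ^+ 2) <=
  (2 * Ginf ^+ 2 + (index t.+1).2.-1%:R * (12 * L ^+ 2 * D ^+ 2) / plenR t.+1)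
    / plenR t.+1 ^+ 2.
Proof.
elim: t => [|t IH].
  rewrite hist_expectS -[leRHS](expect_cst 0); apply: expect_le => h h0.
  have := @grad_error_first h; rewrite h0 /= => /(_ erefl) /le_trans; apply.
  by rewrite mul0r mul0r addr0.
rewrite hist_expectS.
have [k1|k1] := eqVneq (index t.+2).2 1%N.
  rewrite -[leRHS](expect_cst t.+1); apply: expect_le => h ht.
  have := @grad_error_first h; rewrite ht => /(_ k1) /le_trans; apply.
  by rewrite k1 mul0r mul0r addr0.
have ikS : index t.+2 = ((index t.+1).1, (index t.+1).2.+1).
  move: k1; rewrite (@round_indexS t.+1)// /next_round.
  by case: ifP => // _; rewrite eqxx.
have PS : plenR t.+2 = plenR t.+1 by rewrite /plenR ikS.
have [tE k0 kp] := @doubling_round t.+1 isT.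
pose B := `|L| * (2 * D / plenR t.+1).
have P0 : 0 < plenR t.+1 := plen_gt0 _.
have BE : 3 * B ^+ 2 / plenR t.+1 = 12 * L ^+ 2 * D ^+ 2 / plenR t.+1 / plenR t.+1 ^+ 2.
  rewrite /B exprMn real_normK ?num_real//; field; exact: lt0r_neq0.
apply: (@le_trans _ _ (expect t.+1 (fun h => norm2 (grad_error h) ^+ 2 +
    12 * L ^+ 2 * D ^+ 2 / plenR t.+1 / plenR t.+1 ^+ 2))).
  apply: expect_le => -[|w h]// ht; rewrite -BE -PS -ht; apply: grad_error_next.
    by rewrite ht; exact/eqP.
  move=> m j; have [Kx Ky] := run_in_K (w :: h).
  apply: (le_trans ((smooth m j).2 _ _ Kx Ky)).
  apply: (@le_trans _ _ (`|L| * norm2 (cur (run (w :: h)) - prv (run (w :: h))))).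
    by rewrite ler_wpM2r ?norm2_ge0// ler_norm.
  rewrite /B ler_wpM2l//; move: ht => [ht].
  apply: (le_trans (run_step w h)); rewrite mulrAC ler_wpM2l ?mulr_ge0 ?diameter_ge0//.
  by rewrite lef_pV2 ?posrE// ht /plenR ler_nat tE leq_addr.
rewrite hist_expectD expect_cst PS ikS /=.
apply: (le_trans (lerD IH (lexx _))).
rewrite -mulrDl ler_wpM2r ?invr_ge0 ?exprn_ge0 ?(ltW P0)// -addrA lerD2l.
have -> : (index t.+1).2%:R = (index t.+1).2.-1%:R + 1 :> R.
  by rewrite natr1 prednK.
by rewrite le_eqVlt; apply/orP; left; apply/eqP; ring.
Qed.

Let sigma : R := Num.sqrt (2 * (Ginf ^+ 2 + 6 * L ^+ 2 * D ^+ 2)).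

(** The mean square error starts at [2 G^2 / p^2] and grows by
    [12 L^2 D^2 / p^3] in each of the at most [p] rounds of a period; Jensen's
    inequality and [t + 2 = p + k <= 2 p] then give the bound. *)
Lemma expect_grad_error t :
  expect t.+1 (fun h => norm2 (grad_error h)) <= 2 * sigma / t.+2%:R.
Proof.
apply: (le_trans (hist_expect_le_sqrt kernel_ge0 (@kernel_sum1 t.+1) _ _)) => //.
have [tE k0 kp] := @doubling_round t.+1 isT.
have P0 : 0 < plenR t.+1 := plen_gt0 _.
apply: (@le_trans _ _ (sigma / plenR t.+1)); last first.
  rewrite ler_pdivrMr// mulrAC ler_pdivlMr// -mulrA mulrCA ler_wpM2l ?sqrtr_ge0//.
  rewrite /plenR -natrM ler_nat tE mul2n -addnn leq_add2l; exact: kp.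
have -> : sigma / plenR t.+1 =
    Num.sqrt (2 * (Ginf ^+ 2 + 6 * L ^+ 2 * D ^+ 2) / plenR t.+1 ^+ 2).
  have LD := sqr_ge0 (L * D); rewrite exprMn in LD.
  rewrite sqrtrM; last by have := sqr_ge0 Ginf; lra.
  by rewrite -exprVn sqrtr_sqr ger0_norm// invr_ge0 ltW.
rewrite ler_wsqrtr//; apply: (le_trans (grad_error_rec t)).
rewrite ler_wpM2r ?invr_ge0 ?exprn_ge0 ?(ltW P0)//.
have h : (index t.+1).2.-1%:R <= plenR t.+1.
  by rewrite /plenR ler_nat (leq_trans (leq_pred _)).
have LD : 0 <= 12 * L ^+ 2 * D ^+ 2 by rewrite -mulrA -exprMn mulr_ge0// sqr_ge0.
rewrite mulrDr lerD2l ler_pdivrMr// mulrC.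
have -> : 2 * (6 * L ^+ 2 * D ^+ 2) = 12 * L ^+ 2 * D ^+ 2 by ring.
exact: ler_wpM2l.
Qed.

Hypothesis convex_f : forall m j, convex_function K (f m j).
Hypothesis xstarP : is_minimizer K F xstar.

Let gap h := F (cur (run h)) - F xstar.

Let smooth_diameter u v : K u -> K v -> L * norm2 (u - v) ^+ 2 <= L * D ^+ 2.
Proof.
move=> Ku Kv; have uv := norm2_le_diameter kK Ku Kv.
have [L0|D0] := smooth_ge0_or_diameter0 (smooth (Ordinal M0) (Ordinal n0)) Kx1.
  by rewrite ler_wpM2l// lerXn2r ?nnegrE ?norm2_ge0 ?diameter_ge0.
have /eqP -> : norm2 (u - v) == 0 by rewrite eq_le norm2_ge0 -D0 uv.
by rewrite D0.
Qed.

(** The inexact gradient costs [<grad F x - g, v - xstar>], because the vertex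
    [v] is compared with [xstar] through the estimate [g], for which [v] is
    optimal. *)
Lemma gap_step w h (eta : R) : eta = 2 / (size h).+2%:R ->
  gap (w :: h) <= (1 - eta) * gap h + eta * D * norm2 (grad_error (w :: h))
    + L / 2 * eta ^+ 2 * D ^+ 2.
Proof.
move=> etaE; have eta0 : 0 <= eta by rewrite etaE divr_ge0.
set g := est (run (w :: h)); set v := lmo (w :: h) g; set x := cur (run h).
have Kx : K x := (run_in_K h).1.
have Kv : K v := (lmoP (w :: h) g).1.
have Ks : K xstar := xstarP.1.
have Ky : K (cur (run (w :: h))) := (run_in_K (w :: h)).1.
have yx : cur (run (w :: h)) - x = eta *: (v - x).
  by rewrite cur_run -etaE addrC addKr.
have := objective_le_quadratic smooth M0 n0 cK Kx Ky.
rewrite yx dotvZr norm2Z exprMn real_normK ?num_real// => quad.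
have tangent := objective_ge_tangent smooth convex_f Kx Ks.
have opt := (lmoP (w :: h) g).2 xstar Ks; rewrite -/v !(dotvC _ g) in opt.
have err : dotv (grad F x - g) (v - xstar) <= norm2 (grad_error (w :: h)) * D.
  apply: (le_trans (dotv_le_norm2 _ _)); rewrite norm2B.
  by rewrite ler_wpM2l ?norm2_ge0//; exact: norm2_le_diameter.
have LD := smooth_diameter Kv Kx.
have key : dotv (grad F x) (v - x) <= F xstar - F x + norm2 (grad_error (w :: h)) * D.
  by move: tangent err; rewrite !(dotvDl, dotvDr, dotvNl, dotvNr); lra.
have := ler_wpM2l eta0 key.
have := ler_wpM2l (divr_ge0 (sqr_ge0 eta) (ler0n _ 2)) LD.
by move: quad; rewrite /gap; lra.
Qed.

Let Q : R := 4 * D * sigma + 2 * L * D ^+ 2.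

Let Q_ge0 : 0 <= Q.
Proof.
have := smooth_diameter Kx1 Kx1; rewrite subrr norm2_sqr dotv00 mulr0 => LD.
have := mulr_ge0 diameter_ge0 (sqrtr_ge0 (2 * (Ginf ^+ 2 + 6 * L ^+ 2 * D ^+ 2))).
by rewrite /Q /sigma; lra.
Qed.

Lemma expect_gap_step t :
  t.+2%:R * expect t.+1 gap <= t%:R * expect t gap + Q / t.+2%:R.
Proof.
set eta : R := 2 / t.+2%:R.
have t0 : 0 < t.+2%:R :> R by rewrite ltr0n.
have step : expect t.+1 gap <= (1 - eta) * expect t gap +
    eta * D * expect t.+1 (fun h => norm2 (grad_error h)) + L / 2 * eta ^+ 2 * D ^+ 2.
  rewrite -(hist_expect_behead (@kernel_sum1 t.+1) gap (ltnSn t)).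
  rewrite -[X in _ + X](expect_cst t.+1) -!hist_expectZ -!hist_expectD.
  by apply: expect_le => -[|w h]// [ht]; apply: gap_step; rewrite ht.
have e0 : 0 <= eta * D by rewrite mulr_ge0 ?divr_ge0 ?diameter_ge0.
have := ler_wpM2l e0 (expect_grad_error t).
move: step; set E := expect t.+1 gap; set G := expect t gap.
set e := expect t.+1 (fun h => norm2 (grad_error h)).
move=> step noise.
have {step noise} : E <= (1 - eta) * G + eta * D * (2 * sigma / t.+2%:R)
   + L / 2 * eta ^+ 2 * D ^+ 2.
  by apply: (le_trans step); rewrite lerD2r lerD2l.
rewrite -(ler_pM2l t0) => /le_trans; apply.
rewrite le_eqVlt; apply/orP; left; apply/eqP.
have -> : t%:R = t.+2%:R - 2 :> R by rewrite -addn2 natrD addrK.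
rewrite /eta /Q; field; exact: lt0r_neq0.
Qed.

(** The step bound says that [t (t + 1) E gap_t] increases by at most [Q] per
    round. *)
Lemma expect_gap t : (0 < t)%N -> expect t gap <= Q / t%:R.
Proof.
have H s : s%:R * s.+1%:R * expect s gap <= s%:R * Q.
  elim: s => [|s IH]; first by rewrite !mul0r.
  have s1 : 0 <= s.+1%:R :> R by [].
  have s2 : 0 < s.+2%:R :> R by rewrite ltr0n.
  have := ler_wpM2l s1 (expect_gap_step s).
  have : s.+1%:R * (Q / s.+2%:R) <= Q.
    by rewrite mulrA ler_pdivrMr// mulrC ler_wpM2l ?Q_ge0// ler_nat.
  move: IH; rewrite -(natr1 s); set E := expect s _; set E' := expect s.+1 _.
  set q := Q / _; set a : R := s%:R; set c : R := s.+2%:R => *; lra.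
move=> t0; have tR : 0 < t%:R :> R by rewrite ltr0n.
have := H t; rewrite -mulrA ler_pM2l// => {}H.
have t1 : 0 < t.+1%:R :> R by rewrite ltr0n.
apply: (@le_trans _ _ (Q / t.+1%:R)); first by rewrite ler_pdivlMr// mulrC.
by rewrite ler_wpM2l ?Q_ge0// lef_pV2 ?posrE// ler_nat.
Qed.

End QuantizedFrankWolfe.

Theorem theorem5 (R : realType) (d M n T : nat)
    (K : set 'rV[R]_d) (f : 'I_M -> 'I_n -> 'rV[R]_d -> R) (L Ginf : R)
    (x1 xstar : 'rV[R]_d) (lmo : seq (draw d M n) -> 'rV[R]_d -> 'rV[R]_d)
    (disp : measure_display) (Omega : measurableType disp)
    (P : probability Omega R) (xi : nat -> Omega -> draw d M n) :
  (0 < M)%N -> (0 < n)%N -> (0 < T)%N ->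
  convex_set K -> compact K ->
  (forall m j, convex_function K (f m j)) ->
  (forall m j, smooth_on K L (f m j)) ->
  (forall m j x, K x -> `|grad (f m j) x| <= Ginf) ->
  K x1 ->
  is_minimizer K (objective f) xstar ->
  is_lmo K lmo ->
  qfw_run f x1 (qfw_schedule R d M) lmo P T xi ->
  let x_out := qfw_iter f x1 (qfw_schedule R d M) lmo xi T.+1 in
  let D := diameter K in
  (forall om, K (x_out om)) /\
  ('E_P[fun om => objective f (x_out om)] - (objective f xstar)%:E <=
   ((4 * D * Num.sqrt (2 * (Ginf ^+ 2 + 6 * L ^+ 2 * D ^+ 2)) + 2 * L * D ^+ 2)
      / T%:R)%:E)%E.
Proof.
move=> M0 n0 T0 cK kK convex_f smooth grad_bound Kx1 xstarP lmoP [xi_meas xi_law].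
move=> x_out D; split=> [om|].
  exact: (run_in_K f cK Kx1 lmoP _).1.
pose prm := qfw_schedule R d M; pose q := draw_prob f x1 prm lmo.
pose supp := @round_draws R d M n prm.
have q1 h : (size h < T)%N -> \sum_(w <- supp (size h)) q h w = 1.
  by move=> _; exact: (draw_prob_sum1 f x1 prm lmo n0).
have := expectation_history q1 (@round_draws_uniq R d M n prm) xi_meas xi_law
  (fun h => objective f (cur (qfw f x1 prm lmo h))) (leqnn T).
move=> EE; rewrite [X in (X - _)%E]EE -EFinB lee_fin.
apply: le_trans (expect_gap M0 n0 cK kK smooth grad_bound Kx1 lmoP convex_f xstarP T0).
rewrite -[X in _ - X](hist_expect_cst q1 _ (leqnn T)).
by rewrite -mulN1r -hist_expectZ -hist_expectD; under eq_fun do rewrite mulN1r.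
Qed.
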